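(* Let $\psi:[0,1]\to\mathbb{R}$ be a continuous function belonging to $H^1(0,1)$, with $\psi(0)=0$, satisfying $\psi(\theta)+\psi(1-\theta)=1$ for all $\theta\in[0,1]$ and $\int_0^1(1-x)\,\psi(x)\,dx=0$. Let $0<\alpha<1<\beta$ and let $\mathcal{U}_{\alpha,\beta}$ be the family of uniformly regular meshes of $[0,1]$. Then there exists a constant $C$ depending only on $\alpha$ and $\beta$ such that the following holds. For every $f\in L^2(0,1)$, let $u\in H^2(0,1)$ be the solution of $$-u''=f\ \text{ in } ]0,1[,\qquad u(0)=u(1)=0,$$ and let $p=u'$. For every $\mathcal T\in\mathcal U_{\alpha,\beta}$, let $(u_{\mathcal T},p_{\mathcal T})\in U_{\mathcal T}\times P_{\mathcal T}$ be the solution of the finite volume method $$\gamma\big((u_{\mathcal T},p_{\mathcal T}),(v,q)\big)=-(f,v)\qquad\forall\,(v,q)\in U_{\mathcal T}\times Q^{\psi}_{\mathcal T}.$$ Then $$\|u-u_{\mathcal T}\|_0+\|p-p_{\mathcal T}\|_0\le C\,h_{\mathcal T}\,\|f\|_0 .$$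
   Context: Norms: $(\cdot,\cdot)$ and $\|\cdot\|_0$ are the scalar product and norm of $L^2(0,1)$. In one dimension $\mathrm{div}\,q=q'$. Meshes: a mesh $\mathcal T$ with $n=n_{\mathcal T}\ge1$ elements is a set of vertices $0=x_0<x_1<\dots<x_n=1$; its elements are $]x_j,x_{j+1}[$, with lengths $h_{j+1/2}=x_{j+1}-x_j$ ($0\le j\le n-1$), and $h_{\mathcal T}=\max_j h_{j+1/2}$. For $0<\alpha<1<\beta$, $\mathcal U_{\alpha,\beta}$ is the class of all meshes such that $\alpha/n_{\mathcal T}\le h_{j+1/2}\le\beta/n_{\mathcal T}$ for all $j=0,\dots,n_{\mathcal T}-1$. Discrete spaces: $U_{\mathcal T}$ is the space of functions that are constant on each element. $P_{\mathcal T}$ is the space of continuous functions on $[0,1]$ that are affine on each element. $Q^\psi_{\mathcal T}$ is the linear span of the functions $\psi_0,\dots,\psi_n$ on $[0,1]$ defined by $\psi_j(x)=\psi\big(\frac{x-x_{j-1}}{h_{j-1/2}}\big)$ if $x_{j-1}\le x\le x_j$, $\psi_j(x)=\psi\big(\frac{x_{j+1}-x}{h_{j+1/2}}\big)$ if $x_j\le x\le x_{j+1}$, and $\psi_j(x)=0$ elsewhere (for $j=0$ and $j=n$ only the piece lying in $[0,1]$ is used). Bilinear form: $\gamma((u,p),(v,q))=(p,q)+(u,\mathrm{div}\,q)+(\mathrm{div}\,p,v)$. *)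

(* Defs.v *)
(* MathComp-Analysis; the real line is an arbitrary [R : realType]. *)
From HB Require Import structures.
From mathcomp Require Import all_boot all_order all_algebra.
From mathcomp Require Import all_classical all_reals all_analysis.

Set Implicit Arguments.
Unset Strict Implicit.
Unset Printing Implicit Defensive.

Import Order.TTheory GRing.Theory Num.Theory.
Import numFieldNormedType.Exports.

Local Open Scope classical_set_scope.
Local Open Scope ring_scope.

(* Functions on (0,1) or [0,1] are encoded as total functions R -> R whose values
   outside [0,1] play no role; only test functions live on the whole line. *)

Section FunctionSpaces.
Context {R : realType}.
Implicit Types f g u v phi : R -> R.

Definition L2_space f : Prop :=
  f \_ `]0%R, 1%R[ \in Lfun (@lebesgue_measure R) 2%:E%E.

Definition dotL2 f g : R :=
  Rintegral (@lebesgue_measure R) `]0%R, 1%R[ (fun x => f x * g x).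

Definition normL2 f : R := Num.sqrt (dotL2 f f).

(* The space C^1_c(0,1) of test functions. *)
Definition test_function phi : Prop :=
  [/\ forall x, derivable phi x 1,
      continuous (derive1 phi) &
      exists a b : R, [/\ 0 < a, b < 1 &
        forall x, x \notin `[a, b] -> phi x = 0]].

(* In one dimension W^{1,2}(0,1) may be defined by testing against C^1_c(0,1)
   (Brezis, Functional Analysis, Sobolev Spaces and PDEs, Section 8.2). *)
Definition has_weak_derivative u g : Prop :=
  L2_space g /\ forall phi, test_function phi ->
    dotL2 u (derive1 phi) = - dotL2 g phi.

Definition H1_space u : Prop := L2_space u /\ exists g, has_weak_derivative u g.

(* For u in H1_space this is a chosen representative of the weak derivative,
   unique up to equality a.e. on (0,1); [cst 0] is used only outside H1_space. *)
Definition wderiv u : R -> R :=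
  xget (cst 0) [set g : R -> R | has_weak_derivative u g].

Definition H2_space u : Prop := H1_space u /\ H1_space (wderiv u).

(* Continuity on [0,1] selects the representative of u for which the boundary
   values are meaningful. *)
Definition poisson_solution f u : Prop :=
  [/\ {within `[0%R, 1%R], continuous u}, H2_space u,
      {ae @lebesgue_measure R, forall x : R, x \in `]0, 1[ ->
         - wderiv (wderiv u) x = f x} &
      u 0 = 0 /\ u 1 = 0].

End FunctionSpaces.

(* A mesh with vertices 0 = x_0 < x_1 < ... < x_n = 1 is the sequence
   T = [:: x_1; ...; x_n], subject to [itv_partition 0 1 T]; since 0 <> 1 this
   forces n >= 1. *)
Section Meshes.
Context {R : realType}.
Implicit Types (T : seq R) (j : nat).

Definition vertex T j : R := nth 1 (0 :: T) j.

(* h_{j+1/2} *)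
Definition mesh_step T j : R := vertex T j.+1 - vertex T j.

Definition mesh_size T : R := \big[Num.max/0]_(j < size T) mesh_step T j.

Definition uniformly_regular (alpha beta : R) T : Prop :=
  itv_partition 0 1 T /\
  forall j, (j < size T)%N ->
    alpha / (size T)%:R <= mesh_step T j <= beta / (size T)%:R.

Definition U_space T (v : R -> R) : Prop :=
  forall j, (j < size T)%N ->
    exists c : R, forall x, vertex T j < x < vertex T j.+1 -> v x = c.

Definition P_space T (p : R -> R) : Prop :=
  {within `[0%R, 1%R], continuous p} /\
  forall j, (j < size T)%N ->
    exists a b : R, forall x, vertex T j < x < vertex T j.+1 -> p x = a * x + b.

(* The guards 0 < j and j < n remove the piece lying outside [0,1] for the
   first and the last vertex. *)
Definition psi_basis (psi : R -> R) T j (x : R) : R :=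
  if (0 < j)%N && (vertex T j.-1 <= x <= vertex T j) then
    psi ((x - vertex T j.-1) / mesh_step T j.-1)
  else if (j < size T)%N && (vertex T j <= x <= vertex T j.+1) then
    psi ((vertex T j.+1 - x) / mesh_step T j)
  else 0.

Definition Q_space (psi : R -> R) T (q : R -> R) : Prop :=
  exists c : nat -> R, forall x, 0 <= x <= 1 ->
    q x = \sum_(j < (size T).+1) c j * psi_basis psi T j x.

End Meshes.

Section Scheme.
Context {R : realType}.

Definition gamma_form (up vq : (R -> R) * (R -> R)) : R :=
  dotL2 up.2 vq.2 + dotL2 up.1 (wderiv vq.2) + dotL2 (wderiv up.2) vq.1.

Definition fv_solution (psi : R -> R) (T : seq R) (f uT pT : R -> R) : Prop :=
  [/\ U_space T uT, P_space T pT &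
      forall v q : R -> R, U_space T v -> Q_space psi T q ->
        gamma_form (uT, pT) (v, q) = - dotL2 f v].

End Scheme.

(* Main.v *)
Require Import Defs.
From mathcomp Require Import all_boot all_order all_algebra.
From mathcomp Require Import all_classical all_reals all_analysis.
From mathcomp Require Import measurable_realfun.
From mathcomp Require Import ring lra.
Import Order.TTheory GRing.Theory Num.Theory.
Import numFieldNormedType.Exports.
Local Open Scope classical_set_scope.
Local Open Scope ring_scope.

Set Implicit Arguments.
Unset Strict Implicit.
Unset Printing Implicit Defensive.

(** The profile psi enters the scheme only through its values 0 and 1 at the
    endpoints and through two moments. By symmetry its integral is 1/2, and since
    psi is orthogonal to 1 - x its first moment is 1/2 as well. Hence pairing p in P_T with the
    combination of the psi_j with coefficients c_j yields, on each element,
    exactly the trapezoidal value h (p_k c_k + p_(k+1) c_(k+1)) / 2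
    ([segint_P_spline]), and integrating the derivative of that combination
    over an element yields c_(k+1) - c_k. The discrete equations are therefore
    those of a two-point finite volume scheme for the vertex values p_k of p_T
    and the element values u_k of u_T, for every psi; this is why the final
    constant can be chosen before psi.

    Let P be the continuous representative of u', so P' = - f and u is the
    primitive of P vanishing at 0 ([poisson_primitive]). Testing with the
    indicator function of ]0, x_m[ shows that p_T - P takes the same value e at
    all vertices ([fv_flux]): p_T - e is the nodal interpolant of P. Testing
    with the sum of all psi_j, which is the constant 1, shows that p_T has zero
    mean; so has P, since u(0) = u(1). Thus P - p_T is the interpolation error
    minus its mean e, and by Pythagoras
      |P - p_T|^2 + e^2 = |interpolation error|^2 <= h^2 |f|^2
    ([segint_flux_error_sqr]), the last bound because on an element the
    interpolation error is at most the integral of |f| there.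

    Testing with psi_0 + ... + psi_k gives
    u_k = \int_0^(x_k) p_T + h_k p_k / 2 ([fv_value]). Compared with
    u(x) = \int_0^x P for x in the element, the difference consists of the
    integral of P - p_T up to x_k, the integral of P from x_k to x, and the term
    h_k p_k / 2, each at most h |f| ([value_error]).

    All this requires knowing that the weak derivatives of the discrete
    functions exist and integrate to differences of values. This is the
    one-dimensional theory of H^1: a square-integrable function is the weak
    derivative of its primitives
    ([primitive_weak_derivative], by Fubini on a triangle), and conversely a
    function with a weak derivative is almost everywhere a primitive of it
    ([weak_derivative_ae_primitive], the du Bois-Reymond lemma). Functions of
    P_T and Q_T are then recognized as primitives element by element
    ([H1_on_mesh]), with an affine change of variables for the rescaled copies
    of psi ([H1_on_rescale]). *)

Local Notation segint := (parameterized_integral lebesgue_measure).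

(** * Integrals over a segment *)
Section SegmentIntegral.
Context {R : realType}.
Implicit Types (a b c d x y k : R) (F G : R -> R).
Local Notation mu := (@lebesgue_measure R).

Lemma within_continuousD a b F G : {within `[a, b], continuous F} ->
  {within `[a, b], continuous G} ->
  {within `[a, b], continuous (fun x => F x + G x)}.
Proof. by move=> cF cG x; apply: continuousD; [exact: cF|exact: cG]. Qed.

Lemma within_continuousB a b F G : {within `[a, b], continuous F} ->
  {within `[a, b], continuous G} ->
  {within `[a, b], continuous (fun x => F x - G x)}.
Proof. by move=> cF cG x; apply: continuousB; [exact: cF|exact: cG]. Qed.

Lemma within_continuousM a b F G : {within `[a, b], continuous F} ->
  {within `[a, b], continuous G} ->
  {within `[a, b], continuous (fun x => F x * G x)}.
Proof. by move=> cF cG x; apply: continuousM; [exact: cF|exact: cG]. Qed.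

Lemma within_continuous_cst a b k : {within `[a, b], continuous (fun=> k)}.
Proof. by move=> x; exact: cst_continuous. Qed.

Lemma within_continuousW a b c d F : a <= c -> d <= b ->
  {within `[a, b], continuous F} -> {within `[c, d], continuous F}.
Proof.
move=> ac db; apply: continuous_subspaceW => x /=; rewrite !in_itv/=.
by move=> /andP[cx xd]; rewrite (le_trans ac cx) (le_trans xd db).
Qed.

Definition integrable_on a b F : Prop := mu.-integrable `[a, b] (EFin \o F).

Lemma integrable_onW a b c d F :
  a <= c -> d <= b -> integrable_on a b F -> integrable_on c d F.
Proof.
move=> ac db; apply: integrableS => // x /=; rewrite !in_itv/= => /andP[cx xd].
by rewrite (le_trans ac cx) (le_trans xd db).
Qed.

Lemma integrable_on_measurable a b F :
  integrable_on a b F -> measurable_fun `[a, b] F.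
Proof. by move=> /measurable_int /measurable_EFinP. Qed.

Lemma integrable_on_continuous a b F :
  {within `[a, b], continuous F} -> integrable_on a b F.
Proof.
by move=> cF; apply: continuous_compact_integrable => //; exact: segment_compact.
Qed.

Lemma integrable_on_cst a b k : integrable_on a b (fun=> k).
Proof. by apply: integrable_on_continuous => x; exact: cst_continuous. Qed.

(** Statements about an element of a mesh only constrain the open interval; its
    endpoints are negligible, so measurability and integrals pass from there to
    the closed segment. *)
Lemma measurable_fun_eq_oo a b F G :
  (forall x, a < x < b -> F x = G x) ->
  measurable_fun `[a, b] F -> measurable_fun `[a, b] G.
Proof.
move=> FG mF; have mF' : measurable_fun `]a, b[ F.
  by apply: measurable_funS mF => //; exact: subset_itv_oo_cc.
apply: (@measurable_fun_itv_cc _ _ _ false true); apply: eq_measurable_fun mF'.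
by move=> x; rewrite inE/= in_itv/= => /FG.
Qed.

Lemma measurable_fun_oo a b F :
  measurable_fun `[a, b] F -> measurable_fun `]a, b[ F.
Proof. by move=> mF; apply: measurable_funS mF => //; exact: subset_itv_oo_cc. Qed.

Lemma segint_oo a b F : measurable_fun `[a, b] F ->
  segint a b F = \int[mu]_(x in `]a, b[) F x.
Proof.
move=> mF; rewrite /parameterized_integral /Rintegral integral_itv_bndoo//.
by apply/measurable_EFinP; exact: measurable_fun_oo.
Qed.

Lemma segint_eq_oo a b F G : measurable_fun `[a, b] F ->
  (forall x, a < x < b -> F x = G x) -> segint a b F = segint a b G.
Proof.
move=> mF FG; rewrite !segint_oo//; last exact: measurable_fun_eq_oo mF.
by apply: eq_Rintegral => x; rewrite inE/= in_itv/= => /FG.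
Qed.

Lemma integrable_on_oo a b F :
  mu.-integrable `]a, b[ (EFin \o F) -> integrable_on a b F.
Proof.
move=> /integrableP[/measurable_EFinP mF finF].
have mFcc : measurable_fun `[a, b] F.
  exact: (@measurable_fun_itv_cc _ _ _ false true).
apply/integrableP; split; first exact/measurable_EFinP.
by rewrite integral_itv_bndoo//; do 2 apply: measurableT_comp => //.
Qed.

Lemma integrable_on_eq_oo a b F G :
  (forall x, a < x < b -> F x = G x) ->
  integrable_on a b F -> integrable_on a b G.
Proof.
move=> FG iF; apply: integrable_on_oo.
have : mu.-integrable `]a, b[ (EFin \o F).
  by apply: integrableS iF => //; exact: subset_itv_oo_cc.
apply: eq_integrable => // x.
by rewrite inE/= in_itv/= => /FG ->.
Qed.

Lemma integrable_onD a b F G : integrable_on a b F -> integrable_on a b G ->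
  integrable_on a b (fun x => F x + G x).
Proof.
by move=> iF iG; have := @integrableD _ _ _ mu _ (measurable_itv _) _ _ iF iG.
Qed.

Lemma integrable_onB a b F G : integrable_on a b F -> integrable_on a b G ->
  integrable_on a b (fun x => F x - G x).
Proof.
by move=> iF iG; have := @integrableB _ _ _ mu _ (measurable_itv _) _ _ iF iG.
Qed.

Lemma integrable_onZ a b k F : integrable_on a b F ->
  integrable_on a b (fun x => k * F x).
Proof.
by move=> iF; have := @integrableZl _ _ _ mu _ (measurable_itv _) k _ iF.
Qed.

Lemma integrable_on_norm a b F : integrable_on a b F ->
  integrable_on a b (fun x => `|F x|).
Proof. exact: integrable_norm. Qed.

Lemma segintD a b F G : integrable_on a b F -> integrable_on a b G ->
  segint a b (fun x => F x + G x) = segint a b F + segint a b G.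
Proof. by move=> iF iG; rewrite /parameterized_integral RintegralD. Qed.

Lemma segintB a b F G : integrable_on a b F -> integrable_on a b G ->
  segint a b (fun x => F x - G x) = segint a b F - segint a b G.
Proof. by move=> iF iG; rewrite /parameterized_integral RintegralB. Qed.

Lemma segintZ a b k F : integrable_on a b F ->
  segint a b (fun x => k * F x) = k * segint a b F.
Proof. by move=> iF; rewrite /parameterized_integral RintegralZl. Qed.

Lemma segint_cst a b k : a <= b -> segint a b (fun=> k) = k * (b - a).
Proof.
move=> ab; have muab : mu `[a, b] = (b - a)%:E.
  rewrite lebesgue_measure_itv/= lte_fin.
  by move: ab; rewrite le_eqVlt => /predU1P[->|->//]; rewrite ltxx subrr.
transitivity (k * fine (mu `[a, b])); last by rewrite muab.
exact: (Rintegral_cst mu (measurable_itv _)).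
Qed.

Lemma segint_le a b F G : integrable_on a b F -> integrable_on a b G ->
  (forall x, a <= x <= b -> F x <= G x) -> segint a b F <= segint a b G.
Proof.
by move=> iF iG FG; exact: le_Rintegral.
Qed.

Lemma segint_ge0 a b F : (forall x, a <= x <= b -> 0 <= F x) -> 0 <= segint a b F.
Proof.
by move=> F0; apply: Rintegral_ge0 => x; rewrite /= in_itv/= => /F0.
Qed.

Lemma segint_norm_le a b F : integrable_on a b F ->
  `|segint a b F| <= segint a b (fun x => `|F x|).
Proof. by move=> iF; exact: le_normr_Rintegral. Qed.

Lemma segint_eq a b F G : (forall x, a <= x <= b -> F x = G x) ->
  segint a b F = segint a b G.
Proof.
by move=> FG; apply: eq_Rintegral => x; rewrite inE/= in_itv/= => /FG.
Qed.

Lemma segint_xx a F : segint a a F = 0.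
Proof. by rewrite /parameterized_integral set_itv1 Rintegral_set1. Qed.

Lemma segint_chasles a c b F : a <= c -> c <= b -> integrable_on a b F ->
  segint a b F = segint a c F + segint c b F.
Proof.
move=> ac cb iF; have := @Rintegral_itvB _ F (BLeft a) (BRight b) c iF.
rewrite !bnd_simp => /(_ ac cb) /eqP; rewrite subr_eq addrC => /eqP h.
rewrite {1}/parameterized_integral h; congr (_ + _).
rewrite /parameterized_integral Rintegral_itv_obnd_cbnd//.
by apply: integrableS iF => //; apply: subset_itvr; rewrite bnd_simp.
Qed.

Lemma integrable_on_cat a c b F : a <= c -> c <= b ->
  integrable_on a c F -> integrable_on c b F -> integrable_on a b F.
Proof.
move=> ac cb iac icb.
have cover : `[a, b]%classic = `[a, c] `|` `]c, b].
  by rewrite -itv_bndbnd_setU// bnd_simp.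
have icb' : mu.-integrable `]c, b] (EFin \o F).
  by apply: integrableS icb => //; apply: subset_itvr; rewrite bnd_simp.
move/integrableP : iac => [mac iac]; move/integrableP : icb' => [mcb {}icb].
have mF : measurable_fun (`[a, c] `|` `]c, b]) (EFin \o F).
  exact/measurable_funU.
apply/integrableP; rewrite cover; split => //.
rewrite ge0_integral_setU//; first exact: lte_add_pinfty.
- exact: measurableT_comp.
- apply/disj_setPS => x [/=]; rewrite !in_itv/= => /andP[_ xc] /andP[].
  by rewrite ltNge xc.
Qed.

Lemma segint_split a c b F : a <= c -> c <= b ->
  integrable_on a c F -> integrable_on c b F ->
  segint a b F = segint a c F + segint c b F.
Proof.
by move=> ac cb iac icb; apply: segint_chasles => //; exact: integrable_on_cat icb.
Qed.

Lemma segint_primitive_continuous a b F : a <= b -> integrable_on a b F ->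
  {within `[a, b], continuous (fun x => segint a x F)}.
Proof. exact: parameterized_integral_continuous. Qed.

Lemma segint_ae_eq a b F G : integrable_on a b F -> measurable_fun `[a, b] G ->
  {ae mu, forall x, x \in `]a, b[ -> F x = G x} -> segint a b F = segint a b G.
Proof.
move=> iF mG FG; have mF := integrable_on_measurable iF.
rewrite !segint_oo// /Rintegral; congr fine; apply: ae_eq_integral => //.
- by apply/measurable_EFinP; exact: measurable_fun_oo.
- by apply/measurable_EFinP; exact: measurable_fun_oo.
- move: FG; apply: (@filterS _ _ (ae_filter_ringOfSetsType mu)) => x /= FG xab.
  by rewrite FG.
Qed.

Definition square_integrable a b F : Prop :=
  measurable_fun `[a, b] F /\ integrable_on a b (fun x => F x ^+ 2).

Lemma square_integrable_mul a b F G :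
  square_integrable a b F -> square_integrable a b G ->
  integrable_on a b (fun x => F x * G x).
Proof.
move=> [mF iF] [mG iG].
apply: (@le_integrable _ _ _ mu _ _ _ (EFin \o (fun x => F x ^+ 2 + G x ^+ 2))).
- by [].
- by apply/measurable_EFinP; exact: measurable_funM.
- move=> x _ /=; rewrite lee_fin normrM.
  rewrite (ger0_norm (addr_ge0 (sqr_ge0 _) (sqr_ge0 _))).
  rewrite -(real_normK (num_real (F x))) -(real_normK (num_real (G x))).
  have := sqr_ge0 (`|F x| - `|G x|); have := normr_ge0 (F x).
  have := normr_ge0 (G x); nra.
- exact: integrable_onD.
Qed.

Lemma square_integrable_continuous a b F :
  {within `[a, b], continuous F} -> square_integrable a b F.
Proof.
move=> cF; split; first exact: integrable_on_measurable (integrable_on_continuous cF).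
have -> : (fun x => F x ^+ 2) = F \* F by apply/funext => x; rewrite expr2.
by apply: integrable_on_continuous => x; apply: continuousM; exact: cF.
Qed.

Lemma square_integrable_cst a b k : square_integrable a b (fun=> k).
Proof. by apply: square_integrable_continuous => x; exact: cst_continuous. Qed.

Lemma square_integrable_integrable a b F :
  square_integrable a b F -> integrable_on a b F.
Proof.
move=> iF; have := square_integrable_mul iF (square_integrable_cst a b 1).
by apply: eq_integrable => // x _ /=; rewrite mulr1.
Qed.

Lemma square_integrableB a b F G : square_integrable a b F ->
  square_integrable a b G -> square_integrable a b (fun x => F x - G x).
Proof.
move=> iF iG; split; first by apply: measurable_funB; [case: iF|case: iG].
apply: (@eq_integrable _ _ _ mu _ _
  (EFin \o (fun x => (F x ^+ 2 + G x ^+ 2) - 2 * (F x * G x)))) => //.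
- by move=> x _ /=; congr EFin; ring.
apply: integrable_onB; first by apply: integrable_onD; [case: iF|case: iG].
exact/integrable_onZ/square_integrable_mul.
Qed.

Lemma square_integrableZ a b k F : square_integrable a b F ->
  square_integrable a b (fun x => k * F x).
Proof.
move=> [mF iF]; split; first exact: measurable_funM.
by under eq_fun do rewrite exprMn; exact: integrable_onZ.
Qed.

Lemma square_integrableW a b c d F : a <= c -> d <= b ->
  square_integrable a b F -> square_integrable c d F.
Proof.
move=> ac db [mF iF]; split; last exact: integrable_onW iF.
apply: measurable_funS mF => // x /=; rewrite !in_itv/= => /andP[cx xd].
by rewrite (le_trans ac cx) (le_trans xd db).
Qed.

Lemma measurable_fun_cat a c b F : a <= c -> c <= b ->
  measurable_fun `[a, c] F -> measurable_fun `[c, b] F ->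
  measurable_fun `[a, b] F.
Proof.
move=> ac cb mac mcb.
rewrite (@itv_bndbnd_setU _ _ (BLeft a) (BRight c) (BRight b)) ?bnd_simp//.
apply/measurable_funU => //; split => //; apply: measurable_funS mcb => //.
by apply: subset_itvr; rewrite bnd_simp.
Qed.

Lemma square_integrable_cat a c b F : a <= c -> c <= b ->
  square_integrable a c F -> square_integrable c b F -> square_integrable a b F.
Proof.
move=> ac cb [m1 i1] [m2 i2]; split; first exact: measurable_fun_cat m2.
exact: integrable_on_cat i2.
Qed.

Lemma square_integrable_eq_oo a b F G :
  (forall x, a < x < b -> F x = G x) ->
  square_integrable a b F -> square_integrable a b G.
Proof.
move=> FG [mF iF]; split; first exact: measurable_fun_eq_oo mF.
by apply: integrable_on_eq_oo iF => x /FG ->.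
Qed.

(** Cauchy-Schwarz against the constant 1: the square of |F| minus its mean value
    on the segment has a nonnegative integral. *)
Lemma sqr_segint_norm_le a b F : a <= b -> square_integrable a b F ->
  (segint a b (fun x => `|F x|)) ^+ 2 <= (b - a) * segint a b (fun x => F x ^+ 2).
Proof.
rewrite le_eqVlt => /predU1P[<- _|ab iF]; first by rewrite !segint_xx expr0n subrr mul0r.
set m := segint a b (fun x => `|F x|); set h := b - a.
have h0 : 0 < h by rewrite subr_gt0.
have i1 := integrable_on_norm (square_integrable_integrable iF).
have : 0 <= segint a b (fun x => (`|F x| - m / h) ^+ 2).
  by apply: segint_ge0 => x _; exact: sqr_ge0.
rewrite (@segint_eq _ _ _
  (fun x => (F x ^+ 2 - (2 * (m / h)) * `|F x|) + (m / h) ^+ 2)); last first.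
  by move=> x _; rewrite -(real_normK (num_real (F x))); ring.
have i2 := integrable_onZ (2 * (m / h)) i1; have i3 := integrable_onB iF.2 i2.
rewrite (segintD i3 (integrable_on_cst _ _ _)) (segintB iF.2 i2) (segintZ _ i1).
rewrite (segint_cst _ (ltW ab)) -/m -/h.
set s := segint a b (fun x => F x ^+ 2) => s0; suff : 0 <= s - m ^+ 2 / h.
  by rewrite subr_ge0 ler_pdivrMr// (mulrC s).
by move: s0; congr (0 <= _); rewrite -/m; field; rewrite gt_eqF.
Qed.

Lemma segint_norm_le_sqrt F M : square_integrable 0 1 F -> 0 <= M ->
  segint 0 1 (fun x => F x ^+ 2) <= M ^+ 2 -> segint 0 1 (fun x => `|F x|) <= M.
Proof.
move=> L2F M0 FM; rewrite -ler_sqr ?nnegrE//; last by apply: segint_ge0.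
by apply: le_trans FM; have := sqr_segint_norm_le ler01 L2F; rewrite subr0 mul1r.
Qed.

Lemma segint_norm_le01 F a b : 0 <= a -> a <= b -> b <= 1 -> integrable_on 0 1 F ->
  `|segint a b F| <= segint 0 1 (fun x => `|F x|).
Proof.
move=> a0 ab b1 iF; have iN := integrable_on_norm iF.
apply: le_trans (segint_norm_le (integrable_onW a0 b1 iF)) _.
rewrite (segint_chasles a0 (le_trans ab b1) iN).
rewrite (segint_chasles ab b1 (integrable_onW a0 (lexx 1) iN)).
have : 0 <= segint 0 a (fun x => `|F x|) by apply: segint_ge0.
have : 0 <= segint b 1 (fun x => `|F x|) by apply: segint_ge0.
lra.
Qed.

End SegmentIntegral.

(** * Exchange of the order of integration on a triangle *)
Section Triangle.
Context {R : realType}.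
Implicit Types (a b c d x y k t : R) (f g F G : R -> R).
Local Notation mu := (@lebesgue_measure R).

Lemma integral_restrict_scale k c d g : integrable_on c d g ->
  (\int[mu]_t (k * (g \_ `[c, d]) t)%:E = (k * segint c d g)%R%:E)%E.
Proof.
move=> ig; rewrite -(segintZ k ig) fineK; last first.
  by apply: integrable_fin_num => //; exact: (integrable_onZ k ig).
rewrite [RHS]integral_mkcond; apply: eq_integral => t _.
by rewrite !patchE; case: ifP => //; rewrite mulr0.
Qed.

Lemma measurable_below_diagonal : measurable [set z : R * R | z.2 <= z.1].
Proof.
have -> : [set z : R * R | z.2 <= z.1] =
    setT `&` (fun z : R * R => z.1 - z.2) @^-1` `[0, +oo[.
  by apply/seteqP; split=> z /=; rewrite in_itv/= andbT subr_ge0//; case.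
have mB : measurable_fun setT (fun z : R * R => z.1 - z.2).
  by apply: measurable_funB; [exact: measurable_fst|exact: measurable_snd].
exact: mB.
Qed.

(** Both sides integrate f(x) g(t) over the triangle a <= t <= x <= b. *)
Lemma segint_triangle a b f g : integrable_on a b f -> integrable_on a b g ->
  segint a b (fun x => f x * segint a x g) = segint a b (fun t => g t * segint t b f).
Proof.
move=> iF iG; pose D := `[a, b]%classic : set R.
pose A := [set z : R * R | z.2 <= z.1].
have restr h : integrable_on a b h -> mu.-integrable setT (EFin \o (h \_ D)).
  by rewrite /integrable_on integrable_mkcond//= (restrict_EFin h).
have inD y : (y \in D) = (a <= y <= b) by rewrite /D mem_setE in_itv.
have inA x t : ((x, t) \in A) = (t <= x) by apply/idP/idP; rewrite inE.
have [if' ig'] := (restr _ iF, restr _ iG).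
pose h (z : R * R) := (f \_ D) z.1 * ((g \_ D) z.2 * \1_A z).
have mh : measurable_fun setT h.
  apply: measurable_funM.
    apply: measurableT_comp; last exact: measurable_fst.
    by move/measurable_int/measurable_EFinP : if'.
  apply: measurable_funM.
    apply: measurableT_comp; last exact: measurable_snd.
    by move/measurable_int/measurable_EFinP : ig'.
  by apply: measurable_indic; exact: measurable_below_diagonal.
have ih : (mu \x mu)%E.-integrable setT (EFin \o h).
  apply/integrable12ltyP; first exact/measurable_EFinP.
  have fin_g : (\int[mu]_t `|((g \_ D) t)%:E| < +oo)%E by case/integrableP : ig'.
  have fin_f : (\int[mu]_t `|((f \_ D) t)%:E| < +oo)%E by case/integrableP : if'.
  set cg := (\int[mu]_t `|((g \_ D) t)%:E|)%E in fin_g.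
  have mf' : measurable_fun setT (fun x => `|((f \_ D) x)%:E|)%E.
    by apply: measurableT_comp => //; exact: measurable_int if'.
  have mg' : measurable_fun setT (fun x => `|((g \_ D) x)%:E|)%E.
    by apply: measurableT_comp => //; exact: measurable_int ig'.
  apply: (@le_lt_trans _ _ (\int[mu]_x (cg * `|((f \_ D) x)%:E|))%E).
    apply: ge0_le_integral => //.
    - by move=> x _; exact: integral_ge0.
    - apply: (@measurable_fun_fubini_tonelli_F _ _ _ _ _ mu (abse \o (EFin \o h))) => //.
      + by apply: measurableT_comp => //; exact/measurable_EFinP.
      + by move=> z; exact: abse_ge0.
    - exact: measurable_funeM.
    move=> x _; rewrite muleC -ge0_integralZl//.
    apply: ge0_le_integral => //.
    - apply: measurableT_comp => //; apply/measurable_EFinP.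
      exact: (measurableT_comp mh (pair1_measurable x)).
    - exact: measurable_funeM.
    move=> t _; rewrite -EFinM lee_fin /h/= !normrM ler_wpM2l// ler_piMr//.
    by rewrite indicE; case: (_ \in _); rewrite ?normr1 ?normr0.
  rewrite ge0_integralZl//; last exact: integral_ge0.
  by rewrite lte_mul_pinfty// ?integral_ge0// ge0_fin_numE// integral_ge0.
have inner1 x : (\int[mu]_t (h (x, t))%:E)%E =
    (((fun x => f x * segint a x g) \_ D) x)%:E.
  rewrite patchE; case: ifPn => [|xD]; last first.
    by rewrite integral0_eq// => t _; rewrite /h/= patchE (negbTE xD) mul0r.
  rewrite inD => /andP[ax xb].
  rewrite -integral_restrict_scale//; last exact: integrable_onW iG.
  apply: eq_integral => t _; rewrite /h/= patchE ifT; last first.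
    by rewrite inD ax.
  congr (_ * _)%:E; rewrite indicE !patchE inA inD mem_setE in_itv/=.
  have [tx|xt] := leP t x; last first.
    by rewrite mulr0 andbF.
  by rewrite (le_trans tx xb) !andbT mulr1.
have inner2 t : (\int[mu]_x (h (x, t))%:E)%E =
    (((fun t => g t * segint t b f) \_ D) t)%:E.
  rewrite patchE; case: ifPn => [|tD]; last first.
    by rewrite integral0_eq// => x _; rewrite /h/= [(g \_ D) t]patchE (negbTE tD) mul0r mulr0.
  rewrite inD => /andP[at_ tb].
  rewrite -integral_restrict_scale//; last exact: integrable_onW iF.
  apply: eq_integral => x _; rewrite /h/= [(g \_ D) t]patchE ifT; last first.
    by rewrite inD at_.
  rewrite mulrCA; congr (_ * _)%:E; rewrite indicE !patchE inA inD mem_setE in_itv/=.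
  have [tx|xt] := leP t x; last by rewrite mulr0.
  by rewrite (le_trans at_ tx) mulr1.
have := Fubini ih; under eq_integral do rewrite inner1.
under [in RHS]eq_integral do rewrite inner2.
move=> fub; rewrite /parameterized_integral [LHS]Rintegral_mkcond.
by rewrite [RHS]Rintegral_mkcond; exact: (congr1 fine fub).
Qed.

End Triangle.

(** * Primitives are weakly differentiable *)
Section WeakDerivative.
Context {R : realType}.
Implicit Types (a b c d x y k t : R) (f g u v w F G phi tau : R -> R).
Local Notation mu := (@lebesgue_measure R).

(** Passing to the closed segment lets all later integrals be split at vertices
    without tracking which endpoints are included. *)
Lemma L2_spaceP f : L2_space f <-> square_integrable 0 1 f.
Proof.
pose D := `]0%R, 1%R[%classic : set R.
have mD : measurable D by exact: measurable_itv.
have sqr_patch : (fun x => ((f \_ D) x) ^+ 2) = (fun x => f x ^+ 2) \_ D.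
  by apply/funext => x; rewrite !patchE; case: ifP => // _; rewrite expr0n.
split.
- move=> L2f; have := L2f; rewrite /L2_space inE => /andP[/[!inE]/= mf _].
  have mf01 : measurable_fun D f.
    by apply/(measurable_restrictT _ _).2 => //.
  split; first exact: (@measurable_fun_itv_cc _ _ _ false true).
  apply: integrable_on_oo; rewrite integrable_mkcond//= restrict_EFin.
  by have := Lfun2_integrable_sqr L2f; rewrite sqr_patch.
- move=> [mf isqr]; have mfD : measurable_fun setT (f \_ D).
    by exact: ((measurable_restrictT _ mD).1 (measurable_fun_oo mf)).
  rewrite /L2_space inE; apply/andP; split; first by rewrite inE.
  rewrite inE /finite_norm unlock /Lnorm.body; apply: poweR_lty.
  have : mu.-integrable D (EFin \o (fun x => f x ^+ 2)).
    by apply: integrableS isqr => //; exact: subset_itv_oo_cc.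
  rewrite integrable_mkcond//= restrict_EFin -sqr_patch => /integrable_lty => /(_ measurableT).
  apply: le_lt_trans; rewrite le_eqVlt; apply/orP; left; apply/eqP; apply: eq_integral => x _ /=.
  by rewrite powR_mulrn// real_normK ?num_real.
Qed.

Lemma dotL2_segint f g : measurable_fun `[0 : R, 1] (fun x => f x * g x) ->
  dotL2 f g = segint 0 1 (fun x => f x * g x).
Proof. by move=> mfg; rewrite segint_oo. Qed.

Lemma within_continuousT a b F : continuous F -> {within `[a, b], continuous F}.
Proof. exact: continuous_subspaceT. Qed.

Lemma derivable_continuous F : (forall x, derivable F x 1) -> continuous F.
Proof. by move=> dF x; apply/differentiable_continuous/derivable1_diffP. Qed.

Lemma segint_derive1 a b F : a <= b -> (forall x, derivable F x 1) ->
  continuous (derive1 F) -> segint a b (derive1 F) = F b - F a.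
Proof.
rewrite le_eqVlt => /predU1P[<- _ _|ab dF cF']; first by rewrite segint_xx subrr.
have cF := derivable_continuous dF.
rewrite /parameterized_integral /Rintegral (@continuous_FTC2 _ _ F)//.
- exact: within_continuousT.
- split=> //; first exact: cvg_at_right_filter (cF a).
  exact: cvg_at_left_filter (cF b).
Qed.

Lemma test_function_segint phi t : test_function phi -> 0 <= t <= 1 ->
  segint t 1 (derive1 phi) = - phi t.
Proof.
move=> [dphi cphi [a [b [a0 b1 phi0]]]] /andP[t0 t1].
rewrite segint_derive1// [phi 1]phi0 ?sub0r//.
by rewrite in_itv/= [1 <= b]leNgt b1 andbF.
Qed.

Lemma test_function0 phi : test_function phi -> phi 0 = 0.
Proof. by move=> [_ _ [a [b [a0 _ ->]]]]//; rewrite in_itv/= leNgt a0. Qed.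

(** Integration by parts against phi when G is merely a primitive: writing G as an
    integral and exchanging the order of integration leaves
    \int_t^1 phi' = - phi t. *)
Lemma primitive_weak_derivative c g G : square_integrable 0 1 g ->
  (forall x, 0 <= x <= 1 -> G x = c + segint 0 x g) -> has_weak_derivative G g.
Proof.
move=> L2g Gg; split; first exact/L2_spaceP.
move=> phi tphi; have [dphi cphi' _] := tphi.
have ig := square_integrable_integrable L2g.
have L2phi' : square_integrable 0 1 (derive1 phi).
  exact/square_integrable_continuous/within_continuousT.
have L2phi : square_integrable 0 1 phi.
  exact/square_integrable_continuous/within_continuousT/derivable_continuous.
have cG : {within `[0%R, 1%R], continuous (fun x => segint 0 x g)}.
  by apply: segint_primitive_continuous.
have L2int : square_integrable 0 1 (fun x => segint 0 x g).
  exact: square_integrable_continuous.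
have iphi' := square_integrable_integrable L2phi'.
have ip : integrable_on 0 1 (fun x => derive1 phi x * segint 0 x g).
  exact: square_integrable_mul.
have icp : integrable_on 0 1 (fun x => c * derive1 phi x) by exact: integrable_onZ.
have Gphi x : 0 < x < 1 ->
    c * derive1 phi x + derive1 phi x * segint 0 x g = G x * derive1 phi x.
  by move=> /andP[x0 x1]; rewrite Gg ?(ltW x0) ?(ltW x1)//; ring.
have igphi : integrable_on 0 1 (fun x => g x * phi x).
  exact: square_integrable_mul.
have icpp := integrable_onD icp ip.
rewrite !dotL2_segint; last 2 first.
- exact: integrable_on_measurable igphi.
- exact: (integrable_on_measurable (integrable_on_eq_oo Gphi icpp)).
rewrite -(segint_eq_oo (integrable_on_measurable icpp) Gphi).
rewrite segintD// segintZ// (test_function_segint tphi) ?lexx ?ler01// (test_function0 tphi).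
rewrite oppr0 mulr0 add0r segint_triangle// -[RHS]mulN1r -segintZ; last first.
  exact: square_integrable_mul.
apply: segint_eq => t t01; rewrite (test_function_segint tphi)//; ring.
Qed.

Lemma derive1_near_cst F x k : (\forall y \near x, F y = k) -> derive1 F x = 0.
Proof.
move=> Fk; rewrite derive1E (@near_eq_derive _ _ _ F (cst k))//.
exact: derive_cst.
Qed.

(** The tents increase with n to the indicator function of ]a, b[; unlike it they
    are continuous, hence derivatives of C^1 functions. *)
Definition tent a b (n : nat) x : R :=
  Num.max 0 (Num.min 1 (n%:R * Num.min (x - a) (b - x))).

Lemma tent_continuous a b n : continuous (tent a b n).
Proof.
move=> x.
have cl : {for x, continuous (fun y : R => y - a : R^o)}.
  by apply: continuousB => //; exact: cst_continuous.
have cr : {for x, continuous (fun y : R => b - y : R^o)}.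
  by apply: continuousB => //; exact: cst_continuous.
have cn : {for x, continuous (fun y : R => n%:R * Num.min (y - a) (b - y) : R^o)}.
  by apply: continuousM; [exact: cst_continuous|exact: (continuous_min cl cr)].
have c1 : {for x, continuous (cst 1 : R -> R^o)} by exact: cst_continuous.
have c0 : {for x, continuous (cst 0 : R -> R^o)} by exact: cst_continuous.
exact: (continuous_max c0 (continuous_min c1 cn)).
Qed.

Lemma tent_itv01 a b n x : 0 <= tent a b n x <= 1.
Proof. by rewrite /tent le_max lexx ge_max ler01 ge_min lexx. Qed.

Lemma tent_out a b n x : x <= a \/ b <= x -> tent a b n x = 0.
Proof.
move=> xab; apply/max_idPl; rewrite ge_min; apply/orP; right.
apply: mulr_ge0_le0 => //; rewrite ge_min !subr_le0.
by case: xab => ->; rewrite ?orbT.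
Qed.

Lemma tent_cvg a b x : a < x < b -> tent a b n x @[n --> \oo] --> (1 : R).
Proof.
move=> /andP[ax xb]; set m := Num.min (x - a) (b - x).
have m0 : 0 < m by rewrite lt_min !subr_gt0 ax.
apply: cvg_near_cst; near=> n; rewrite /tent -/m.
have -> : Num.min 1 (n%:R * m) = 1.
  apply/min_idPl; rewrite -ler_pdivrMr// div1r ltW//.
  by near: n; exact: nbhs_infty_gtr.
exact/max_idPr.
Unshelve. all: by end_near. Qed.

End WeakDerivative.

(** * The du Bois-Reymond lemma *)
Section DuBoisReymond.
Context {R : realType}.
Implicit Types (a b c d x y k t : R) (f g u v w F G phi tau : R -> R).
Local Notation mu := (@lebesgue_measure R).

(** The zero mean makes the primitive vanish to the right of the support, so it is
    compactly supported. *)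
Lemma primitive_test_function a b tau : 0 < a -> b < 1 -> continuous tau ->
  (forall x, x \notin `[a, b] -> tau x = 0) -> segint 0 1 tau = 0 ->
  exists2 phi, test_function phi & derive1 phi = tau.
Proof.
move=> a0 b1 ctau tau0 int0.
have itau : integrable_on 0 1 tau.
  exact/integrable_on_continuous/within_continuousT.
have in01 t : t \in `[a, b] -> t \in `[0, 1].
  rewrite !in_itv/= => /andP[a_t t_b].
  by rewrite (le_trans (ltW a0) a_t) (le_trans t_b (ltW b1)).
have patch01 : tau \_ `[0, 1] = tau.
  apply/funext => t; rewrite patchE mem_setE; case: ifPn => // t01.
  by rewrite tau0//; apply: contra t01; exact: in01.
have itauT : mu.-integrable setT (EFin \o tau).
  by move: itau; rewrite /integrable_on integrable_mkcond//= restrict_EFin patch01.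
pose phi x := \int[mu]_(t in `]-oo, x]) tau t.
have ftc x : derivable phi x 1 /\ derive1 phi x = tau x.
  have xx1 : x < x + 1 by rewrite ltrDl.
  apply: (@continuous_FTC1 _ tau -oo%O x (x + 1) xx1); [|by rewrite ltNyr|exact: ctau].
  exact: integrableS itauT.
have dphi : derive1 phi = tau by apply/funext => x; case: (ftc x).
exists phi => //; split.
- by move=> x; case: (ftc x).
- by rewrite dphi.
exists a, b; split=> // x xab; rewrite /phi Rintegral_mkcond.
have [xa|ax] := ltP x a.
  rewrite (@eq_Rintegral _ _ _ mu setT (cst 0)); last first.
    move=> t _; rewrite patchE mem_setE in_itv/=; case: ifP => // tx.
    by rewrite tau0// in_itv/= negb_and -ltNge (le_lt_trans tx xa).
  by rewrite Rintegral_cst// mul0r.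
have bx : b < x by move: xab; rewrite in_itv/= ax/= -ltNge.
rewrite -int0 /parameterized_integral [RHS]Rintegral_mkcond patch01.
apply: eq_Rintegral => t _; rewrite patchE mem_setE; case: ifPn => // tx.
rewrite tau0//; apply: contra tx; rewrite !in_itv/= => /andP[_ tb].
exact: le_trans tb (ltW bx).
Qed.

Lemma integrable_on_tent c d a b n w : integrable_on c d w ->
  integrable_on c d (fun x => w x * tent a b n x).
Proof.
move=> iw; apply: (@le_integrable _ _ _ mu _ _ _ (EFin \o w)) => //.
- apply/measurable_EFinP; apply: measurable_funM.
    exact: integrable_on_measurable iw.
  apply: integrable_on_measurable; apply: integrable_on_continuous.
  exact/within_continuousT/tent_continuous.
- move=> x _ /=; rewrite lee_fin normrM ler_piMr//.
  by have /andP[t0 t1] := tent_itv01 a b n x; rewrite ger0_norm.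
Qed.

Lemma segint_tent a b n w : 0 <= a -> a < b -> b <= 1 -> integrable_on 0 1 w ->
  segint 0 1 (fun x => w x * tent a b n x) = segint a b (fun x => w x * tent a b n x).
Proof.
move=> a0 ab b1 iw; have iwt := integrable_on_tent a b n iw.
rewrite (@segint_chasles _ 0 a 1)// ?(le_trans (ltW ab))//.
rewrite (@segint_chasles _ a b 1) ?(ltW ab)//; last exact: integrable_onW iwt.
rewrite (@segint_eq _ 0 a _ (fun=> 0)); last first.
  by move=> x /andP[_ xa]; rewrite tent_out ?mulr0//; left.
rewrite (@segint_eq _ b 1 _ (fun=> 0)); last first.
  by move=> x /andP[bx _]; rewrite tent_out ?mulr0//; right.
by rewrite !segint_cst// !mul0r add0r addr0.
Qed.

(** Dominated convergence, with |w| as the dominating function. *)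
Lemma cvg_segint_tent a b w : 0 <= a -> a < b -> b <= 1 -> integrable_on 0 1 w ->
  segint 0 1 (fun x => w x * tent a b n x) @[n --> \oo] --> segint a b w.
Proof.
move=> a0 ab b1 iw.
under eq_cvg do rewrite segint_tent//.
have iabw : integrable_on a b w by exact: integrable_onW iw.
pose L x := w x * (a < x < b)%R%:R.
have wL x : a < x < b -> w x = L x by move=> xab; rewrite /L xab mulr1.
have mw := integrable_on_measurable iabw.
have mL : measurable_fun `[a, b] L := measurable_fun_eq_oo wL mw.
rewrite (segint_eq_oo mw wL).
have mt n : measurable_fun `[a, b] (fun x => w x * tent a b n x).
  by apply: integrable_on_measurable; exact: integrable_on_tent.
have [] := @dominated_convergence _ _ _ mu `[a, b] _
  (fun n => EFin \o (fun x => w x * tent a b n x)) (EFin \o L)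
  (abse \o (EFin \o w)).
- by [].
- by move=> n; apply/measurable_EFinP; exact: mt.
- exact/measurable_EFinP.
- apply: aeW => x _; apply: cvg_EFin; first by near=> n.
  rewrite /L; have [xab|] := boolP (a < x < b).
    by apply: cvgM; [exact: cvg_cst|exact: tent_cvg].
  rewrite negb_and -!leNgt => /orP xab.
  by under eq_cvg do rewrite /= tent_out//; exact: cvg_cst.
- exact: integrable_abse.
- apply: aeW => x n _ /=; rewrite lee_fin normrM ler_piMr//.
  by have /andP[t0 t1] := tent_itv01 a b n x; rewrite ger0_norm.
move=> iL _; rewrite -[X in _ --> X -> _]fineK; last exact: integrable_fin_num.
by move/fine_cvg.
Unshelve. all: by end_near. Qed.

(** A tent tau is not the derivative of a test function, but tau - (s/m) eta is,
    where eta is a fixed tent of integral m > 0 and s is the integral of tau.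
    Hence the integral of w against tau is proportional to that of tau; letting
    tau increase to the indicator function of ]a, b[ gives the claim. *)
Lemma weakly_constant_segint w : integrable_on 0 1 w ->
  (forall phi, test_function phi -> segint 0 1 (fun x => w x * derive1 phi x) = 0) ->
  exists c, forall a b, 0 < a -> a < b -> b < 1 -> segint a b w = c * (b - a).
Proof.
move=> iw w0.
have tent1 a b : 0 < a -> a < b -> b < 1 ->
    segint 0 1 (tent a b n) @[n --> \oo] --> b - a.
  move=> a0 ab b1; have := cvg_segint_tent (ltW a0) ab (ltW b1) (integrable_on_cst 0 1 1).
  rewrite (segint_cst _ (ltW ab)) mul1r.
  have e : (fun n => segint 0 1 (fun x => 1 * tent a b n x)) =
      (fun n => segint 0 1 (tent a b n)).
    by apply: funext => n; apply: segint_eq => x _; rewrite mul1r.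
  by rewrite e.
have [n0 m_gt0] : exists n0, 0 < segint 0 1 (tent (4^-1 : R) (3 / 4) n0).
  have h : (4^-1 : R) < 3 / 4 by lra.
  have h1 : (3 / 4 : R) < 1 by lra.
  have h0 : (0 : R) < 4^-1 by lra.
  have := tent1 _ _ h0 h h1.
  move/cvgr_gt => /(_ 0); rewrite subr_gt0 => /(_ h) [N _ /(_ N)]/= hN.
  by exists N; apply: hN.
set eta := tent _ _ _ in m_gt0; set m := segint 0 1 eta in m_gt0.
(* The constant is the mean of w weighted by eta. *)
exists (segint 0 1 (fun x => w x * eta x) / m) => a b a0 ab b1.
set c := _ / m.
have key n : segint 0 1 (fun x => w x * tent a b n x) = c * segint 0 1 (tent a b n).
  set s := segint 0 1 (tent a b n).
  have ctent (p q : R) i : square_integrable 0 1 (tent p q i).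
    exact/square_integrable_continuous/within_continuousT/tent_continuous.
  have it := square_integrable_integrable (ctent a b n).
  have ie := square_integrable_integrable (ctent 4^-1 (3 / 4) n0).
  have iwt (p q : R) i : integrable_on 0 1 (fun x => w x * tent p q i x).
    exact: integrable_on_tent.
  pose tau x := tent a b n x - s / m * eta x.
  have ctau : continuous tau.
    move=> x; apply: continuousB; first exact: tent_continuous.
    by apply: continuousM; [exact: cst_continuous|exact: tent_continuous].
  have [|||||phi tphi dphi] := @primitive_test_function (Num.min a 4^-1) (Num.max b (3 / 4)) tau.
  - by rewrite lt_min a0/=; lra.
  - by rewrite gt_max b1/=; lra.
  - by [].
  - move=> x; rewrite in_itv/= negb_and -!ltNge lt_min gt_max /tau /eta.
    by move=> /orP[/andP[xa xq]|/andP[bx qx]]; rewrite !tent_out ?mulr0 ?subr0//;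
      (by left; apply: ltW) || (by right; apply: ltW).
  - rewrite /tau segintB ?segintZ -/s -/m//; last exact: integrable_onZ.
    by rewrite divfK ?subrr// gt_eqF.
  have := w0 _ tphi; rewrite dphi /tau.
  rewrite (@segint_eq _ _ _ _ (fun x => w x * tent a b n x - s / m * (w x * eta x))); last first.
    by move=> x _; ring.
  have iwe : integrable_on 0 1 (fun x => w x * eta x) by exact: iwt.
  rewrite (segintB (iwt _ _ _) (integrable_onZ _ iwe)) (segintZ _ iwe).
  by move=> /eqP; rewrite subr_eq0 => /eqP ->; rewrite /c; ring.
have lim1 := cvg_segint_tent (ltW a0) ab (ltW b1) iw.
have lim2 : segint 0 1 (fun x => w x * tent a b n x) @[n --> \oo] --> c * (b - a).
  by under eq_cvg do rewrite key; apply: cvgM; [exact: cvg_cst|exact: tent1].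
exact: (cvg_unique (@Rhausdorff R) lim1 lim2).
Qed.

Lemma segint_zero_cst v x y : integrable_on 0 1 v ->
  (forall a b, 0 < a -> a < b -> b < 1 -> segint a b v = 0) ->
  0 < x < 1 -> 0 < y < 1 -> segint 0 y v = segint 0 x v.
Proof.
move=> iv v0 /andP[x0 x1] /andP[y0 y1].
have [xy|yx|->//] := ltgtP x y.
- rewrite (segint_chasles (ltW x0) (ltW xy)); last exact: integrable_onW (ltW y1) iv.
  by rewrite (v0 x y)// addr0.
- rewrite (segint_chasles (ltW y0) (ltW yx)); last exact: integrable_onW (ltW x1) iv.
  by rewrite (v0 y x)// addr0.
Qed.

(** By Lebesgue differentiation v is almost everywhere the derivative of its
    primitive, which is constant on ]0, 1[. *)
Lemma segint_zero_ae v : integrable_on 0 1 v ->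
  (forall a b, 0 < a -> a < b -> b < 1 -> segint a b v = 0) ->
  {ae mu, forall x, x \in `]0, 1[ -> v x = 0}.
Proof.
move=> iv v0; pose v1 := v \_ `[0, 1].
have iv1 : mu.-integrable setT (EFin \o v1).
  by move: iv; rewrite /integrable_on integrable_mkcond//= restrict_EFin.
have locv : locally_integrable setT v1 by exact: integrable_locally.
have iv1y y : mu.-integrable [set` Interval (BLeft 0) (BRight y)] (EFin \o v1).
  exact: integrableS iv1.
have := FTC1 iv1y locv; apply: (@filterS _ _ (ae_filter_ringOfSetsType mu)).
move=> x /= ftc x01; have /andP[x0 x1] : 0 < x < 1 by move: x01; rewrite in_itv.
have [_] := ftc x0; rewrite {2}/v1 patchE mem_setE in_itv/= (ltW x0) (ltW x1)/= => <-.
apply: (@derive1_near_cst _ _ x (segint 0 x v)).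
move/near_in_itvoo : x01; apply: filterS => y; rewrite in_itv/= => y01.
rewrite -(@segint_zero_cst v x y)// ?x0//; apply: segint_eq => t /andP[t0 ty].
case/andP: y01 => _ y1.
by rewrite /v1 patchE mem_setE in_itv/= t0 (le_trans ty (ltW y1)).
Qed.

(** The difference between u and the primitive of g has zero weak derivative. *)
Lemma weak_derivative_ae_primitive u g : L2_space u -> has_weak_derivative u g ->
  exists c, {ae mu, forall x, x \in `]0, 1[ -> u x = c + segint 0 x g}.
Proof.
move=> /L2_spaceP L2u [/L2_spaceP L2g wg].
have [_ wG] : has_weak_derivative (fun x => segint 0 x g) g.
  by apply: (@primitive_weak_derivative _ 0) => // x _; rewrite add0r.
have ig := square_integrable_integrable L2g.
have L2G : square_integrable 0 1 (fun x => segint 0 x g).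
  exact/square_integrable_continuous/segint_primitive_continuous.
pose w x := u x - segint 0 x g.
have L2w : square_integrable 0 1 w by exact: square_integrableB.
have iw := square_integrable_integrable L2w.
have [|c wc] := weakly_constant_segint iw.
  move=> phi tphi; have [_ cphi _] := tphi.
  have L2phi : square_integrable 0 1 (derive1 phi).
    exact/square_integrable_continuous/within_continuousT.
  have iuphi := square_integrable_mul L2u L2phi.
  have iGphi := square_integrable_mul L2G L2phi.
  rewrite (@segint_eq _ _ _ _
    (fun x => u x * derive1 phi x - segint 0 x g * derive1 phi x)); last first.
    by move=> x _; rewrite /w mulrBl.
  rewrite (segintB iuphi iGphi) -(dotL2_segint (integrable_on_measurable iuphi)).
  by rewrite -(dotL2_segint (integrable_on_measurable iGphi)) wg// wG// subrr.
exists c; have ic := integrable_on_cst 0 1 c.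
have := @segint_zero_ae (fun x => w x - c) (integrable_onB iw ic).
have w0 a b : 0 < a -> a < b -> b < 1 -> segint a b (fun x => w x - c) = 0.
  move=> a0 ab b1; rewrite segintB; last first.
  - exact: integrable_on_cst.
  - exact: integrable_onW (ltW a0) (ltW b1) iw.
  by rewrite wc// segint_cst ?(ltW ab)// subrr.
move=> /(_ w0); apply: (@filterS _ _ (ae_filter_ringOfSetsType mu)) => x /= wxc x01.
by have /eqP := wxc x01; rewrite /w subr_eq0 subr_eq => /eqP.
Qed.

Lemma continuous_oo_eq a b F G : a < b -> {within `[a, b], continuous F} ->
  {within `[a, b], continuous G} -> (forall x, a < x < b -> F x = G x) ->
  forall x, a <= x <= b -> F x = G x.
Proof.
move=> ab cF cG FG x.
have /(continuous_within_itvP _ ab)[_ cda cdb] := within_continuousB cF cG.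
have zero y : F y - G y = 0 -> F y = G y by move/eqP; rewrite subr_eq0 => /eqP.
move=> /andP[]; rewrite le_eqVlt => /predU1P[<- _|ax].
  apply: zero; have z : (F x - G x) @[x --> a^'+] --> (0 : R).
    by apply: cvg_near_cst; near=> y; rewrite FG ?subrr//; apply/andP; split.
  exact: (cvg_unique (@Rhausdorff R) cda z).
rewrite le_eqVlt => /predU1P[->|xb]; last by rewrite FG// ax.
apply: zero; have z : (F x - G x) @[x --> b^'-] --> (0 : R).
  by apply: cvg_near_cst; near=> y; rewrite FG ?subrr//; apply/andP; split.
exact: (cvg_unique (@Rhausdorff R) cdb z).
Unshelve. all: by end_near. Qed.

(** The primitive of u - v is constant, and at an interior point its derivative is
    u - v by continuity. *)
Lemma continuous_ae_eq u v : {within `[0%R, 1%R], continuous u} ->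
  {within `[0%R, 1%R], continuous v} ->
  {ae mu, forall x, x \in `]0, 1[ -> u x = v x} ->
  forall x, 0 <= x <= 1 -> u x = v x.
Proof.
move=> cu cv uv; apply: (continuous_oo_eq ltr01) => //.
have [iu iv] := (integrable_on_continuous cu, integrable_on_continuous cv).
pose d x := u x - v x.
have cd : {within `[0%R, 1%R], continuous d}.
  by move=> x; apply: continuousB; [exact: cu|exact: cv].
have id01 := integrable_on_continuous cd.
have d0 a b : 0 < a -> a < b -> b < 1 -> segint a b d = 0.
  move=> a0 ab b1; have a_0 := ltW a0; have b_1 := ltW b1.
  rewrite segintB; [|exact: integrable_onW iu|exact: integrable_onW iv].
  apply/eqP; rewrite subr_eq0; apply/eqP; apply: segint_ae_eq.
  - exact: integrable_onW iu.
  - by apply: integrable_on_measurable; exact: integrable_onW iv.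
  - move: uv; apply: (@filterS _ _ (ae_filter_ringOfSetsType mu)) => x /= uv.
    by rewrite in_itv/= => /andP[ax xb]; rewrite uv// in_itv/= (lt_trans a0 ax) (lt_trans xb b1).
have /(continuous_within_itvP _ ltr01)[cdoo _ _] := cd.
move=> x x01; have /andP[x0 x1] := x01.
have cdx : {for x, continuous d} by apply: cdoo; rewrite in_itv.
apply/eqP; rewrite -subr_eq0 -/(d x); apply/eqP.
have [_ <-] := continuous_FTC1_closed x1 id01 x0 cdx.
apply: (@derive1_near_cst _ _ x (segint 0 x d)).
have : x \in `]0, 1[ by rewrite in_itv.
move/near_in_itvoo; apply: filterS => y; rewrite in_itv/= => y01.
exact: segint_zero_cst.
Qed.

(** The weak derivative [wderiv u] is an arbitrary choice among functions that
    agree almost everywhere; this identity is what makes its integrals computable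
    from the values of u. *)
Lemma H1_continuous_primitive u : {within `[0%R, 1%R], continuous u} ->
  H1_space u -> square_integrable 0 1 (wderiv u) /\
    forall x, 0 <= x <= 1 -> u x = u 0 + segint 0 x (wderiv u).
Proof.
move=> cu [L2u [g ug]].
have wu : has_weak_derivative u (wderiv u).
  by apply: (@xgetPex _ (cst 0) [set g | has_weak_derivative u g]); exists g.
have L2w : square_integrable 0 1 (wderiv u) by case: wu => /L2_spaceP.
split=> //; have [c uc] := weak_derivative_ae_primitive L2u wu.
have cG : {within `[0%R, 1%R], continuous (fun x => c + segint 0 x (wderiv u))}.
  apply: within_continuousD; first exact: within_continuous_cst.
  exact/segint_primitive_continuous/square_integrable_integrable.
have ucG := continuous_ae_eq cu cG uc.
have u0 : u 0 = c by rewrite ucG ?lexx ?ler01// segint_xx addr0.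
by move=> x x01; rewrite u0 ucG.
Qed.

End DuBoisReymond.

(** * Affine rescaling and gluing of primitives *)
Section AffineChange.
Context {R : realType}.
Implicit Types (a b c d h x y k t : R) (f g u v w F G : R -> R).
Local Notation mu := (@lebesgue_measure R).

Definition rescale a h x : R := (x - a) / h.

Lemma measurable_rescale a h :
  measurable_fun setT (rescale a h : measurableTypeR R -> measurableTypeR R).
Proof.
have mr : measurable_fun setT (rescale a h).
  by apply: measurable_funM; [exact: measurable_funB|exact: measurable_cst].
exact: mr.
Qed.

Lemma preimage_rescale_cc a h c d : 0 < h ->
  rescale a h @^-1` `[c, d] = `[a + h * c, a + h * d]%classic.
Proof.
move=> h0; apply/seteqP; split=> x /=; rewrite !in_itv/= /rescale;
  by rewrite ler_pdivlMr// ler_pdivrMr// lerBrDl lerBlDl !(mulrC h).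
Qed.

(** Lebesgue measure is characterized by its values on half-open intervals, on
    which the scaled image measure agrees with it. *)
Lemma lebesgue_measure_rescale a h (h0 : 0 < h) (A : set R) : measurable A ->
  mu (rescale a h @^-1` A) = (h%:E * mu A)%E.
Proof.
move=> mA; have hi0 : 0 <= h^-1 by rewrite invr_ge0 ltW.
have mu_eq : mu A =
    mscale (NngNum hi0) (pushforward mu (rescale a h : _ -> measurableTypeR R)) A.
  have uniq := @lebesgue_measure_unique R
    (mscale (NngNum hi0) (pushforward mu (rescale a h : _ -> measurableTypeR R))).
  move=> mr; refine (uniq mr _ A mA).
  move=> _ [[c d] _ <-]/=.
  rewrite /mscale/= /pushforward.
  have -> : rescale a h @^-1` `]c, d] = `]a + h * c, a + h * d]%classic.
    apply/seteqP; split=> x /=; rewrite !in_itv/= /rescale;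
      by rewrite ltr_pdivlMr// ler_pdivrMr// ltrBrDl lerBlDl !(mulrC h).
  rewrite !lebesgue_measure_itv/= !lte_fin ltrD2l ltr_pM2l//.
  case: ifP => // _; last by rewrite mule0.
  by rewrite -!EFinD -EFinM; congr EFin; field; rewrite gt_eqF.
rewrite (mu_eq (measurable_rescale a h)) /mscale/= muleA -EFinM divff ?gt_eqF// mul1e.
by [].
Qed.

Lemma ge0_integral_rescale a h c d (f : R -> \bar R) : 0 < h ->
  measurable_fun `[c, d] f -> (forall y, `[c, d]%classic y -> (0 <= f y)%E) ->
  (\int[mu]_(x in `[(a + h * c)%R, (a + h * d)%R]) f (rescale a h x) =
   h%:E * \int[mu]_(y in `[c, d]) f y)%E.
Proof.
move=> h0 mf f0; rewrite -preimage_rescale_cc//.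
have := @ge0_integral_pushforward _ _ _ _ R _ (measurable_rescale a h) mu `[c, d] f.
move=> /(_ _ mf) <-; last 2 first.
- by [].
- by move=> y /set_mem; exact: f0.
have h0' : 0 <= h by exact: ltW.
rewrite -(@ge0_integral_mscale _ _ _ mu `[c, d] _ (NngNum h0') f)//.
apply: eq_measure_integral; first exact: measurable_rescale.
by move=> mr A mA _; exact: (lebesgue_measure_rescale a h0 mA).
Qed.

Lemma measurable_fun_rescale a h c d F : 0 < h -> measurable_fun `[c, d] F ->
  measurable_fun `[a + h * c, a + h * d] (fun x => F (rescale a h x)).
Proof.
move=> h0 mF; apply: (measurable_comp (F := `[c, d])) => //.
- by move=> _ [x xD <-]; move: xD; rewrite -preimage_rescale_cc.
- exact: measurable_funTS (measurable_rescale a h).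
Qed.

Lemma integrable_on_rescale a h c d F : 0 < h -> integrable_on c d F ->
  integrable_on (a + h * c) (a + h * d) (fun x => F (rescale a h x)).
Proof.
move=> h0 iF; have mF := integrable_on_measurable iF.
apply/integrableP; split.
  by apply/measurable_EFinP; exact: measurable_fun_rescale.
rewrite (@ge0_integral_rescale a h c d (fun y => `|(F y)%:E|%E))//.
  by case/integrableP : iF => _ finF; rewrite lte_mul_pinfty// lee_fin ltW.
by apply: measurableT_comp => //; exact/measurable_EFinP.
Qed.

(** The nonnegative case follows from the image measure; the general one by writing
    F as (F + |F|) - |F|. *)
Lemma segint_rescale a h c d F : 0 < h -> integrable_on c d F ->
  segint (a + h * c) (a + h * d) (fun x => F (rescale a h x)) = h * segint c d F.
Proof.
move=> h0 iF.
have ge0 G : integrable_on c d G -> (forall x, 0 <= G x) ->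
    segint (a + h * c) (a + h * d) (fun x => G (rescale a h x)) = h * segint c d G.
  move=> iG G0; rewrite /parameterized_integral /Rintegral.
  rewrite (@ge0_integral_rescale a h c d (EFin \o G))//.
  - rewrite fineM//; apply: integrable_fin_num => //.
  - by apply/measurable_EFinP; exact: integrable_on_measurable.
  - by move=> y _; rewrite lee_fin.
have iN := integrable_on_norm iF; have iS := integrable_onD iF iN.
transitivity (h * (segint c d (fun x => F x + `|F x|) - segint c d (fun x => `|F x|))); last first.
  by rewrite (segintD iF iN) addrK.
rewrite mulrBr -!ge0//; last by move=> x; rewrite -(opprK (F x)) addrC subr_ge0 normrN ler_norm.
rewrite (segintD (integrable_on_rescale a h0 iF) (integrable_on_rescale a h0 iN)).
by rewrite addrK.
Qed.

(** The continuous representatives of H^1(a, b). Stated with primitives rather than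
    test functions, membership is stable under concatenation of segments and under
    rescaling. *)
Definition H1_on a b F := exists2 g, square_integrable a b g &
  forall x, a <= x <= b -> F x = F a + segint a x g.

Lemma H1_on_eq a b F G : a <= b -> (forall x, a <= x <= b -> F x = G x) ->
  H1_on a b F -> H1_on a b G.
Proof.
move=> ab FG [g L2g Fg]; exists g => // x xab.
by rewrite -!FG ?lexx// Fg.
Qed.

Lemma H1_on_affine a b k d : H1_on a b (fun x => k * x + d).
Proof.
exists (fun=> k); first exact: square_integrable_cst.
by move=> x /andP[ax _]; rewrite segint_cst//; ring.
Qed.

Lemma H1_on_cst a b k : H1_on a b (fun=> k).
Proof.
exists (fun=> 0); first exact: square_integrable_cst.
by move=> x /andP[ax _]; rewrite segint_cst// mul0r addr0.
Qed.

Lemma H1_on_cat a c b F : a <= c -> c <= b ->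
  H1_on a c F -> H1_on c b F -> H1_on a b F.
Proof.
move=> ac cb [g1 L1 F1] [g2 L2 F2].
pose g x := if x < c then g1 x else g2 x.
have g1g x : a < x < c -> g1 x = g x by move=> /andP[_ xc]; rewrite /g xc.
have g2g x : c < x < b -> g2 x = g x.
  by move=> /andP[cx _]; rewrite /g ltNge (ltW cx).
have L2g : square_integrable a b g.
  apply: (square_integrable_cat ac cb).
  - exact: square_integrable_eq_oo L1.
  - exact: square_integrable_eq_oo L2.
exists g => // x /andP[ax xb].
have L1m := L1.1; have L2m := L2.1.
have [xc|cx] := leP x c.
  rewrite F1 ?ax//; congr (_ + _); apply: segint_eq_oo.
    by have [] := square_integrableW (lexx a) xc L1.
  by move=> t /andP[a_t tx]; apply: g1g; rewrite a_t (lt_le_trans tx xc).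
have icx : integrable_on a x g.
  exact: integrable_onW (lexx a) xb (square_integrable_integrable L2g).
rewrite (segint_chasles ac (ltW cx) icx) F2 ?(ltW cx)// F1 ?ac ?lexx// -addrA.
congr (_ + (_ + _)); first exact: segint_eq_oo.
apply: segint_eq_oo; first by have [] := square_integrableW (lexx c) xb L2.
by move=> t /andP[ct tx]; apply: g2g; rewrite ct (lt_le_trans tx xb).
Qed.

Lemma H1_onB a b F G : H1_on a b F -> H1_on a b G ->
  H1_on a b (fun x => F x - G x).
Proof.
move=> [f L2f Ff] [g L2g Gg]; exists (fun x => f x - g x).
  exact: square_integrableB.
move=> x xab; rewrite segintB; first by rewrite Ff// Gg//; ring.
- apply: integrable_onW (square_integrable_integrable L2f) => //.
  by case/andP: xab.
- apply: integrable_onW (square_integrable_integrable L2g) => //.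
  by case/andP: xab.
Qed.

Lemma H1_onZ a b k F : H1_on a b F -> H1_on a b (fun x => k * F x).
Proof.
move=> [g L2g Fg]; exists (fun x => k * g x); first exact: square_integrableZ.
move=> x xab; have /andP[ax xb] := xab.
have ig := integrable_onW (lexx a) xb (square_integrable_integrable L2g).
by rewrite (segintZ k ig) (Fg x xab); ring.
Qed.

Lemma square_integrable_rescale a h c d F : 0 < h -> square_integrable c d F ->
  square_integrable (a + h * c) (a + h * d) (fun x => F (rescale a h x)).
Proof.
move=> h0 [mF iF]; split; first exact: measurable_fun_rescale.
exact: (integrable_on_rescale a h0 iF).
Qed.

Lemma H1_on_rescale a h F : 0 < h -> H1_on 0 1 F ->
  H1_on a (a + h) (fun x => F (rescale a h x)).
Proof.
move=> h0 [g L2g Fg]; exists (fun x => h^-1 * g (rescale a h x)).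
  have := square_integrable_rescale a h0 L2g; rewrite mulr0 mulr1 addr0.
  exact: square_integrableZ.
move=> x /andP[ax xah]; have r01 : 0 <= rescale a h x <= 1.
  by rewrite /rescale divr_ge0 ?subr_ge0 ?(ltW h0)//= ler_pdivrMr// mul1r lerBlDl.
have xE : x = a + h * rescale a h x.
  by rewrite /rescale; field; rewrite gt_eqF.
have ig : integrable_on 0 (rescale a h x) g.
  case/andP: r01 => _ r1.
  exact: integrable_onW (lexx 0) r1 (square_integrable_integrable L2g).
have igr := integrable_on_rescale a h0 ig; rewrite mulr0 addr0 -xE in igr.
have ir := segint_rescale a h0 ig; rewrite mulr0 addr0 -xE in ir.
rewrite (segintZ _ igr) ir mulrA mulVf ?gt_eqF// mul1r Fg//; congr (_ + _).
by rewrite /rescale subrr mul0r.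
Qed.

Lemma H1_on_continuous a b F : a <= b -> H1_on a b F ->
  {within `[a, b], continuous F}.
Proof.
move=> ab [g L2g Fg].
have cG : {within `[a, b], continuous (fun x => F a + segint a x g)}.
  apply: within_continuousD; first exact: within_continuous_cst.
  exact/segint_primitive_continuous/square_integrable_integrable.
apply: subspace_eq_continuous cG => x /set_mem/=; rewrite in_itv => xab.
exact: esym (Fg _ xab).
Qed.

Lemma H1_on_H1_space F : H1_on 0 1 F -> H1_space F.
Proof.
move=> HF; split.
  exact/L2_spaceP/square_integrable_continuous/H1_on_continuous.
by have [g L2g Fg] := HF; exists g; exact: primitive_weak_derivative L2g Fg.
Qed.

Lemma H1_space_on F : {within `[0%R, 1%R], continuous F} ->
  H1_space F -> H1_on 0 1 F.
Proof. by move=> cF /(H1_continuous_primitive cF)[L2 Fg]; exists (wderiv F). Qed.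

Lemma segint_wderiv a b F : 0 <= a -> a <= b -> b <= 1 -> H1_on 0 1 F ->
  segint a b (wderiv F) = F b - F a.
Proof.
move=> a0 ab b1 HF; have cF := H1_on_continuous ler01 HF.
have [L2 Fg] := H1_continuous_primitive cF (H1_on_H1_space HF).
rewrite (Fg b) ?b1 ?(le_trans a0)// (Fg a) ?a0 ?(le_trans ab)//.
rewrite (segint_chasles a0 ab); first ring.
exact: integrable_onW (lexx 0) b1 (square_integrable_integrable L2).
Qed.

End AffineChange.

(** * Meshes and piecewise functions *)
Section Mesh.
Context {R : realType}.
Implicit Types (a b h x y t : R) (T : seq R) (c : nat -> R) (i j k m : nat)
  (f g u v w p q psi F G : R -> R).
Local Notation mu := (@lebesgue_measure R).

Lemma vertex0 T : vertex T 0 = 0. Proof. by []. Qed.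

Lemma vertex_size T : itv_partition 0 1 T -> vertex T (size T) = 1.
Proof. by move=> [_ /eqP <-]; rewrite /vertex (last_nth 1). Qed.

Lemma vertex_ltS T k : itv_partition 0 1 T -> (k < size T)%N ->
  vertex T k < vertex T k.+1.
Proof. by move=> [/(pathP 1) + _]; exact. Qed.

Lemma vertex_le T i j : itv_partition 0 1 T -> (i <= j <= size T)%N ->
  vertex T i <= vertex T j.
Proof.
move=> hT /andP[]; elim: j => [|j IH]; first by rewrite leqn0 => /eqP ->.
rewrite leq_eqVlt => /predU1P[->//|ij jT].
by apply: le_trans (ltW (vertex_ltS hT jT)); rewrite IH// ltnW.
Qed.

Lemma vertex_ge0 T k : itv_partition 0 1 T -> (k <= size T)%N -> 0 <= vertex T k.
Proof. by move=> hT kT; rewrite -(vertex0 T) vertex_le. Qed.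

Lemma vertex_le1 T k : itv_partition 0 1 T -> (k <= size T)%N -> vertex T k <= 1.
Proof. by move=> hT kT; rewrite -(vertex_size hT) vertex_le// kT leqnn. Qed.

Lemma mesh_step_gt0 T k : itv_partition 0 1 T -> (k < size T)%N ->
  0 < mesh_step T k.
Proof. by move=> hT kT; rewrite subr_gt0 vertex_ltS. Qed.

Lemma vertexS T k : vertex T k.+1 = vertex T k + mesh_step T k.
Proof. by rewrite /mesh_step addrC subrK. Qed.

Lemma mesh_step_le_size T k : (k < size T)%N -> mesh_step T k <= mesh_size T.
Proof.
move=> kT; rewrite /mesh_size.
exact: (le_bigmax _ (fun j : 'I_(size T) => mesh_step T j) (Ordinal kT)).
Qed.

Lemma mesh_size_ge0 T : 0 <= mesh_size T.
Proof. exact: bigmax_ge_id. Qed.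

Lemma mesh_size_le1 T : itv_partition 0 1 T -> mesh_size T <= 1.
Proof.
move=> hT; apply: bigmax_le => // j _; rewrite /mesh_step lerBlDl.
apply: le_trans (vertex_le1 hT (ltn_ord j)) _.
by rewrite lerDr vertex_ge0// ltnW.
Qed.

Lemma segint_mesh T F m : itv_partition 0 1 T -> (m <= size T)%N ->
  (forall k, (k < m)%N -> integrable_on (vertex T k) (vertex T k.+1) F) ->
  integrable_on 0 (vertex T m) F /\
  segint 0 (vertex T m) F = \sum_(k < m) segint (vertex T k) (vertex T k.+1) F.
Proof.
move=> hT; elim: m => [_ _|m IH mT iF].
  rewrite vertex0 big_ord0 segint_xx; split=> //.
  apply: (@integrable_on_eq_oo _ _ _ (fun=> 0)); last exact: integrable_on_cst.
  by move=> x /andP[/lt_trans/[apply]]; rewrite ltxx.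
have [|i0 e0] := IH (ltnW mT); first by move=> k km; apply: iF; exact: ltnW.
have m0 := vertex_ge0 hT (ltnW mT); have ms := ltW (vertex_ltS hT mT).
split; first exact: integrable_on_cat i0 (iF _ _).
by rewrite (segint_split m0 ms i0 (iF _ _))// e0 big_ord_recr.
Qed.

Lemma H1_on_mesh T F : itv_partition 0 1 T ->
  (forall k, (k < size T)%N -> H1_on (vertex T k) (vertex T k.+1) F) ->
  H1_on 0 1 F.
Proof.
move=> hT HF; rewrite -(vertex_size hT).
suff : forall m, (m <= size T)%N -> H1_on 0 (vertex T m) F by apply.
elim=> [_|m IH mT].
  apply: (@H1_on_eq _ _ _ (fun=> F 0)) => //; last exact: H1_on_cst.
  by move=> x; rewrite vertex0 => x0; congr F; apply: le_anti.
apply: (@H1_on_cat _ _ (vertex T m)).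
- exact: vertex_ge0 (ltnW mT).
- exact/ltW/vertex_ltS.
- exact/IH/ltnW.
- exact: HF.
Qed.

(** At a vertex shared by two elements both branches of the definition may apply;
    they agree because psi vanishes at 0 and both give psi 1 at the vertex that
    carries the basis function. *)
Lemma psi_basis_element psi T j k x : itv_partition 0 1 T -> psi 0 = 0 ->
  (j <= size T)%N -> (k < size T)%N -> vertex T k <= x <= vertex T k.+1 ->
  psi_basis psi T j x =
    (j == k)%:R * psi ((vertex T k.+1 - x) / mesh_step T k) +
    (j == k.+1)%:R * psi ((x - vertex T k) / mesh_step T k).
Proof.
move=> hT psi0 jT kT /andP[kx xk]; rewrite /psi_basis.
have [jk|kj|->] := ltngtP j k.
- have jT' : (j < size T)%N by exact: ltn_trans kT.
  have jx : vertex T j.+1 <= x.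
    by apply: le_trans kx; apply: vertex_le => //; rewrite jk ltnW.
  have jjx : vertex T j < x by apply: lt_le_trans jx; exact: vertex_ltS.
  rewrite [x <= vertex T j]leNgt jjx !andbF.
  rewrite (ltn_eqF (ltn_trans jk (ltnSn k))) !mul0r addr0.
  case: ifP => // /andP[_ /andP[_ xj]].
  have -> : x = vertex T j.+1 by apply: le_anti; rewrite xj jx.
  by rewrite subrr mul0r.
- move: kj; rewrite leq_eqVlt mul0r add0r => /predU1P[<-|kj].
    by rewrite eqxx /= kx xk mul1r.
  rewrite (gtn_eqF kj) mul0r; case: j kj jT => // j; rewrite ltnS => kj jT /=.
  have xj : x <= vertex T j.
    by apply: le_trans xk _; apply: vertex_le => //; rewrite kj ltnW.
  have xjj : x < vertex T j.+1 by apply: le_lt_trans xj _; exact: vertex_ltS.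
  rewrite [vertex T j.+1 <= x]leNgt xjj /= andbF.
  case: ifP => // /andP[jx _].
  have -> : x = vertex T j by apply: le_anti; rewrite xj jx.
  by rewrite subrr mul0r.
- rewrite (ltn_eqF (ltnSn k)) mul0r addr0 mul1r kT kx xk /=.
  case: ifP => // /andP[k0 /andP[_ xk']].
  have -> : x = vertex T k by apply: le_anti; rewrite xk' kx.
  have k1T : (k.-1 < size T)%N by rewrite (leq_trans _ kT)// ltnS leq_pred.
  have := mesh_step_gt0 hT k1T; rewrite /mesh_step prednK// => hk1.
  by rewrite !divff ?gt_eqF// -/(mesh_step _ _) mesh_step_gt0.
Qed.

Definition spline psi T c x : R :=
  \sum_(j < (size T).+1) c j * psi_basis psi T j x.

(** On an element only the basis functions of its two vertices are present, and by
    the symmetry of psi they sum to 1. *)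
Lemma spline_element psi T c k x : itv_partition 0 1 T -> psi 0 = 0 ->
  (forall theta : R, 0 <= theta <= 1 -> psi theta + psi (1 - theta) = 1) ->
  (k < size T)%N -> vertex T k <= x <= vertex T k.+1 ->
  spline psi T c x =
    c k + (c k.+1 - c k) * psi (rescale (vertex T k) (mesh_step T k) x).
Proof.
move=> hT psi0 psi1 kT kx; have hk := mesh_step_gt0 hT kT.
set r := rescale _ _ x.
have r01 : 0 <= r <= 1.
  move/andP: kx => [kx xk].
  apply/andP; split; first by apply: divr_ge0; [rewrite subr_ge0|exact: ltW].
  by rewrite ler_pdivrMr// mul1r lerB.
have rE : (vertex T k.+1 - x) / mesh_step T k = 1 - r.
  by rewrite vertexS /r /rescale; field; rewrite gt_eqF.
have psi1r : psi (1 - r) = 1 - psi r by have := psi1 r r01; lra.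
transitivity (\sum_(j < (size T).+1) (c j * (j == k :> nat)%:R * (1 - psi r) +
    c j * (j == k.+1 :> nat)%:R * psi r)).
  apply: eq_bigr => j _; rewrite (psi_basis_element hT psi0 _ kT kx) ?leq_ord//.
  by rewrite rE psi1r mulrDr !mulrA.
have sel i : (i <= size T)%N ->
    \sum_(j < (size T).+1) c j * (j == i :> nat)%:R = c i.
  rewrite -ltnS => iT; rewrite (bigD1 (Ordinal iT))//= eqxx mulr1 big1 ?addr0//.
  by move=> j ji; rewrite (_ : (j == i :> nat) = false) ?mulr0//; apply/negbTE.
rewrite big_split/= -!mulr_suml !sel//; last exact: ltnW.
ring.
Qed.

End Mesh.

(** * The discrete equations *)
Section Scheme.
Context {R : realType}.
Implicit Types (a b h x y t : R) (T : seq R) (c : nat -> R) (i j k m : nat)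
  (f g u v w p q psi F G : R -> R).
Local Notation mu := (@lebesgue_measure R).

Lemma dotL2_0r v : dotL2 v (fun=> 0) = 0.
Proof.
rewrite /dotL2 (@eq_Rintegral _ _ _ mu _ (fun=> 0)); last first.
  by move=> x _; rewrite mulr0.
by rewrite Rintegral_cst// mul0r.
Qed.

Definition cutoff b x : R := if x < b then 1 else 0.

Lemma dotL2_cutoff F b : 0 <= b <= 1 -> square_integrable 0 1 F ->
  dotL2 F (cutoff b) = segint 0 b F.
Proof.
move=> /andP[b0 b1] L2F; have iF := square_integrable_integrable L2F.
have F1 x : 0 < x < b -> F x = F x * cutoff b x.
  by move=> /andP[_ xb]; rewrite /cutoff xb mulr1.
have F2 x : b < x < 1 -> 0 = F x * cutoff b x.
  by move=> /andP[bx _]; rewrite /cutoff ltNge (ltW bx) mulr0.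
have iF0 := integrable_onW (lexx 0) b1 iF.
have i0 := integrable_on_cst b 1 0.
have i1 := integrable_on_eq_oo F1 iF0; have i2 := integrable_on_eq_oo F2 i0.
rewrite dotL2_segint; last exact: integrable_on_measurable (integrable_on_cat b0 b1 i1 i2).
rewrite (segint_split b0 b1 i1 i2) -(segint_eq_oo (integrable_on_measurable iF0) F1).
by rewrite -(segint_eq_oo (integrable_on_measurable i0) F2) segint_cst// mul0r addr0.
Qed.

Lemma within_continuous_id a b : {within `[a, b], continuous (fun x : R => x)}.
Proof. by apply: within_continuousT => x. Qed.

Lemma segint_onem F : {within `[0%R, 1%R], continuous F} ->
  segint 0 1 F = segint 0 1 (fun x => F (1 - x)).
Proof.
move=> cF; have := @Rintegration_by_substitution_onem R F 1.
by rewrite /unstable.onem subrr lexx ler01 => /(_ isT cF).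
Qed.

Lemma segint_id : segint 0 1 (fun x : R => x) = 2^-1.
Proof.
have cid := @within_continuous_id 0 1; have := segint_onem cid.
rewrite (segintB (integrable_on_cst _ _ _) (integrable_on_continuous cid)).
by rewrite segint_cst// mul1r; lra.
Qed.

(** The midpoint is a convenient point of the open element, where elements of U_T
    are constant. *)
Definition element_value T v k : R := v ((vertex T k + vertex T k.+1) / 2).

Lemma U_space_element T v k x : U_space T v -> (k < size T)%N ->
  vertex T k < x < vertex T k.+1 -> v x = element_value T v k.
Proof.
move=> Uv kT kx; have [c vc] := Uv _ kT; rewrite (vc _ kx) /element_value vc//.
case/andP: kx => kx xk; by have [-> ->] := midf_lt (lt_trans kx xk).
Qed.

Lemma P_space_element T p k : itv_partition 0 1 T -> P_space T p ->
  (k < size T)%N -> forall x, vertex T k <= x <= vertex T k.+1 ->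
  p x = p (vertex T k) + (p (vertex T k.+1) - p (vertex T k)) *
          rescale (vertex T k) (mesh_step T k) x.
Proof.
move=> hT [cp affp] kT x kx; have [a [b pab]] := affp _ kT.
have kk := vertex_ltS hT kT; have hk := mesh_step_gt0 hT kT.
have caff : {within `[vertex T k, vertex T k.+1], continuous (fun x => a * x + b)}.
  exact/H1_on_continuous/H1_on_affine/ltW.
have cpk : {within `[vertex T k, vertex T k.+1], continuous p}.
  apply: within_continuousW cp; first exact/vertex_ge0/ltnW.
  exact: vertex_le1.
have pE := continuous_oo_eq kk cpk caff pab.
have pl : p (vertex T k) = a * vertex T k + b by rewrite pE// lexx ltW.
have pr : p (vertex T k.+1) = a * vertex T k.+1 + b by rewrite pE// lexx ltW.
by rewrite (pE _ kx) pl pr /rescale vertexS; field; rewrite gt_eqF.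
Qed.

Lemma P_space_H1 T p : itv_partition 0 1 T -> P_space T p -> H1_on 0 1 p.
Proof.
move=> hT Pp; apply: (H1_on_mesh hT) => k kT; have [_ affp] := Pp.
have kk := ltW (vertex_ltS hT kT); have hk := mesh_step_gt0 hT kT.
set dp := p (vertex T k.+1) - p (vertex T k).
apply: (@H1_on_eq _ _ _ (fun x => dp / mesh_step T k * x +
  (p (vertex T k) - dp / mesh_step T k * vertex T k))) => //; last exact: H1_on_affine.
move=> x kx; rewrite (P_space_element hT Pp kT kx) -/dp /rescale; field.
by rewrite gt_eqF.
Qed.

Section Profile.
Variable psi : R -> R.
Hypothesis psi_cont : {within `[0%R, 1%R], continuous psi}.
Hypothesis psi_H1 : H1_space psi.
Hypothesis psi0 : psi 0 = 0.
Hypothesis psi_sym : forall t, 0 <= t <= 1 -> psi t + psi (1 - t) = 1.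
Hypothesis psi_orth : segint 0 1 (fun x => (1 - x) * psi x) = 0.

Let ipsi : integrable_on 0 1 psi.
Proof. exact: integrable_on_continuous. Qed.

Let ixpsi : integrable_on 0 1 (fun x => x * psi x).
Proof.
apply/integrable_on_continuous/within_continuousM => //.
exact: within_continuous_id.
Qed.

(** The substitution x -> 1 - x turns psi into 1 - psi. *)
Lemma segint_profile : segint 0 1 psi = 2^-1.
Proof.
suff : segint 0 1 psi = 1 - segint 0 1 psi by lra.
rewrite {1}(segint_onem psi_cont) (@segint_eq _ _ _ _ (fun x => 1 - psi x)); last first.
  by move=> x x01; have := psi_sym x01; lra.
by rewrite (segintB (integrable_on_cst _ _ _) ipsi) segint_cst// mul1r subr0.
Qed.

Lemma segint_profile_id : segint 0 1 (fun x => x * psi x) = 2^-1.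
Proof.
have e : segint 0 1 (fun x => psi x - x * psi x) = 0.
  by rewrite -[RHS]psi_orth; apply: segint_eq => x _; ring.
by move: e; rewrite (segintB ipsi ixpsi) segint_profile; lra.
Qed.

(** The integrals over [0, 1] of x, psi and x psi are all 1/2, which is what makes
    the right-hand side symmetric in the two endpoints. *)
Lemma segint_affine_profile (p0 dp c0 dc : R) :
  segint 0 1 (fun s => (p0 + dp * s) * (c0 + dc * psi s)) =
  (p0 * c0 + (p0 + dp) * (c0 + dc)) / 2.
Proof.
have iid := integrable_on_continuous (@within_continuous_id 0 1).
have i1 := integrable_on_cst (0 : R) 1 (p0 * c0).
have i2 := integrable_onZ (dp * c0) iid.
have i3 := integrable_onZ (p0 * dc) ipsi.
have i4 := integrable_onZ (dp * dc) ixpsi.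
rewrite (@segint_eq _ _ _ _ (fun s => (p0 * c0 + dp * c0 * s) +
    (p0 * dc * psi s + dp * dc * (s * psi s)))); last by move=> s _; ring.
rewrite (segintD (integrable_onD i1 i2) (integrable_onD i3 i4)).
rewrite (segintD i1 i2) (segintD i3 i4) (segintZ _ iid).
rewrite (segintZ _ ipsi) (segintZ _ ixpsi) segint_cst// segint_id segint_profile segint_profile_id.
by field.
Qed.

Section OnMesh.
Variable T : seq R.
Hypothesis hT : itv_partition 0 1 T.

Lemma spline_Q c : Q_space psi T (spline psi T c).
Proof. by exists c. Qed.

Lemma profile1 : psi 1 = 1.
Proof. by have := psi_sym (t := 0); rewrite lexx ler01 psi0 add0r subr0; apply. Qed.

Lemma spline_vertexl c k : (k < size T)%N -> spline psi T c (vertex T k) = c k.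
Proof.
move=> kT; rewrite (spline_element c hT psi0 psi_sym kT) ?lexx ?(ltW (vertex_ltS hT kT))//.
by rewrite /rescale subrr mul0r psi0 mulr0 addr0.
Qed.

Lemma spline_vertexr c k : (k < size T)%N ->
  spline psi T c (vertex T k.+1) = c k.+1.
Proof.
move=> kT; have hk := mesh_step_gt0 hT kT.
rewrite (spline_element c hT psi0 psi_sym kT) ?lexx ?(ltW (vertex_ltS hT kT))//.
by rewrite /rescale -/(mesh_step T k) divff ?gt_eqF// profile1; ring.
Qed.

Lemma spline_H1 c : H1_on 0 1 (spline psi T c).
Proof.
apply: (H1_on_mesh hT) => k kT; have hk := mesh_step_gt0 hT kT.
have kk := ltW (vertex_ltS hT kT).
apply: (@H1_on_eq _ _ _ (fun x => c k - (c k - c k.+1) *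
   psi (rescale (vertex T k) (mesh_step T k) x))) => //.
  by move=> x kx; rewrite (spline_element c hT psi0 psi_sym kT kx); ring.
apply: H1_onB; first exact: H1_on_cst.
apply: H1_onZ; rewrite vertexS; apply: H1_on_rescale => //.
exact: H1_space_on.
Qed.

(** The trapezoidal rule: exact, and the same for every admissible psi. *)
Lemma segint_P_spline p c k : P_space T p -> (k < size T)%N ->
  segint (vertex T k) (vertex T k.+1) (fun x => p x * spline psi T c x) =
  mesh_step T k * ((p (vertex T k) * c k + p (vertex T k.+1) * c k.+1) / 2).
Proof.
move=> Pp kT; have hk := mesh_step_gt0 hT kT.
set p0 := p (vertex T k); set dp := p (vertex T k.+1) - p0.
pose G s := (p0 + dp * s) * (c k + (c k.+1 - c k) * psi s).
have cid := @within_continuous_id 0 1.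
have cG : {within `[0%R, 1%R], continuous G}.
  apply: within_continuousM; apply: within_continuousD;
    do ?[exact: within_continuous_cst]; apply: within_continuousM => //;
    exact: within_continuous_cst.
have := segint_rescale (vertex T k) hk (integrable_on_continuous cG).
rewrite mulr0 mulr1 addr0 -vertexS segint_affine_profile => e.
transitivity (mesh_step T k * ((p0 * c k + (p0 + dp) * (c k + (c k.+1 - c k))) / 2)).
  rewrite -e; apply: segint_eq => x kx.
  by rewrite (P_space_element hT Pp kT kx) (spline_element c hT psi0 psi_sym kT kx).
by rewrite /dp; congr (_ * (_ / 2)); ring.
Qed.

Lemma dotL2_U_wderiv v q : U_space T v -> H1_on 0 1 q ->
  dotL2 v (wderiv q) = \sum_(k < size T)
    element_value T v k * (q (vertex T k.+1) - q (vertex T k)).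
Proof.
move=> Uv Hq.
have [L2q _] := H1_continuous_primitive (H1_on_continuous ler01 Hq) (H1_on_H1_space Hq).
have iq k : (k < size T)%N -> integrable_on (vertex T k) (vertex T k.+1) (wderiv q).
  move=> kT; apply: integrable_onW (square_integrable_integrable L2q).
    exact/vertex_ge0/ltnW.
  exact: vertex_le1.
have Uk k : (k < size T)%N -> forall x, vertex T k < x < vertex T k.+1 ->
    element_value T v k * wderiv q x = v x * wderiv q x.
  by move=> kT x kx; rewrite (U_space_element Uv kT kx).
have ivq k : (k < size T)%N ->
    integrable_on (vertex T k) (vertex T k.+1) (fun x => v x * wderiv q x).
  by move=> kT; apply: integrable_on_eq_oo (Uk _ kT) _; exact/integrable_onZ/iq.
have [i01 e] := segint_mesh hT (leqnn _) ivq; rewrite vertex_size// in i01 e.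
rewrite dotL2_segint; last exact: integrable_on_measurable.
rewrite e; apply: eq_bigr => k _; have kT := ltn_ord k.
have iqk := iq _ kT; have ivk := integrable_onZ (element_value T v k) iqk.
rewrite -(segint_eq_oo (integrable_on_measurable ivk) (Uk _ kT)) (segintZ _ iqk).
rewrite segint_wderiv//; [exact/vertex_ge0/ltnW|exact/ltW/vertex_ltS|].
exact: vertex_le1.
Qed.

Lemma dotL2_P_spline p c : P_space T p ->
  dotL2 p (spline psi T c) = \sum_(k < size T) mesh_step T k *
    ((p (vertex T k) * c k + p (vertex T k.+1) * c k.+1) / 2).
Proof.
move=> Pp; have [cp _] := Pp.
have cs := H1_on_continuous ler01 (spline_H1 c).
have ips := integrable_on_continuous (within_continuousM cp cs).
rewrite dotL2_segint; last exact: integrable_on_measurable.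
have ik k : (k < size T)%N ->
    integrable_on (vertex T k) (vertex T k.+1) (fun x => p x * spline psi T c x).
  move=> kT; apply: integrable_onW ips; first exact/vertex_ge0/ltnW.
  exact: vertex_le1.
have [_ e] := segint_mesh hT (leqnn _) ik; rewrite vertex_size// in e.
rewrite e; apply: eq_bigr => k _; exact: segint_P_spline.
Qed.

Lemma cutoff_U m : (m <= size T)%N -> U_space T (cutoff (vertex T m)).
Proof.
move=> mT k kT; have [km|mk] := ltnP k m.
  exists 1 => x /andP[_ xk]; rewrite /cutoff (lt_le_trans xk)//.
  by apply: vertex_le => //; rewrite km.
exists 0 => x /andP[kx _]; rewrite /cutoff ltNge (le_trans _ (ltW kx))//.
by apply: vertex_le => //; rewrite mk ltnW.
Qed.

Variables f uT pT : R -> R.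
Hypothesis L2f : square_integrable 0 1 f.
Hypothesis solT : fv_solution psi T f uT pT.

(** Discrete conservation, tested with the indicator function of ]0, x_m[ and
    q = 0. *)
Lemma fv_flux m : (m <= size T)%N ->
  pT (vertex T m) - pT 0 = - segint 0 (vertex T m) f.
Proof.
move=> mT; have [UuT PpT gam] := solT; have HpT := P_space_H1 hT PpT.
have m01 : 0 <= vertex T m <= 1 by rewrite vertex_ge0// vertex_le1.
have L2w : square_integrable 0 1 (wderiv pT).
  by case: (H1_continuous_primitive (H1_on_continuous ler01 HpT) (H1_on_H1_space HpT)).
have Q0 : Q_space psi T (fun=> 0).
  by exists (fun=> 0) => x _; rewrite big1// => j _; rewrite mul0r.
have := gam _ _ (cutoff_U mT) Q0; rewrite /gamma_form/= dotL2_0r.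
rewrite (dotL2_U_wderiv UuT (H1_on_cst 0 1 0)) big1; last first.
  by move=> k _; rewrite subrr mulr0.
rewrite !dotL2_cutoff// add0r add0r => <-.
by case/andP: m01 => m0 m1; rewrite segint_wderiv.
Qed.

(** The second discrete equation, tested with v = 0 and an arbitrary q in Q_T. *)
Lemma fv_gradient c :
  \sum_(k < size T) mesh_step T k *
    ((pT (vertex T k) * c k + pT (vertex T k.+1) * c k.+1) / 2) +
  \sum_(k < size T) element_value T uT k * (c k.+1 - c k) = 0.
Proof.
have [UuT PpT gam] := solT.
have U0 : U_space T (fun=> 0) by move=> k _; exists 0.
have := gam _ _ U0 (spline_Q c); rewrite /gamma_form/= !dotL2_0r addr0 oppr0.
rewrite dotL2_P_spline// (dotL2_U_wderiv UuT (spline_H1 c)) => h.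
rewrite -[RHS]h; congr (_ + _); apply: eq_bigr => k _.
by rewrite (spline_vertexr c (ltn_ord k)) (spline_vertexl c (ltn_ord k)).
Qed.

End OnMesh.
End Profile.
End Scheme.

(** * Error estimates *)
Section Estimate.
Context {R : realType}.
Implicit Types (a b h x y t : R) (T : seq R) (c : nat -> R) (i j k m : nat)
  (f g u v w p q psi F G : R -> R).
Local Notation mu := (@lebesgue_measure R).

(** P is the continuous representative of the derivative of u. *)
Lemma poisson_primitive f u : L2_space f -> poisson_solution f u ->
  exists P : R -> R, [/\ {within `[0%R, 1%R], continuous P},
    forall x, 0 <= x <= 1 -> P x = P 0 - segint 0 x f,
    {ae mu, forall x, x \in `]0, 1[ -> wderiv u x = P x},
    square_integrable 0 1 (wderiv u) &
    forall x, 0 <= x <= 1 -> u x = segint 0 x P].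
Proof.
move=> /L2_spaceP L2f [cu [H1u [L2p [g pg]]] u''f [u0 _]].
have wu : has_weak_derivative (wderiv u) (wderiv (wderiv u)).
  by apply: (@xgetPex _ (cst 0) [set g | has_weak_derivative (wderiv u) g]); exists g.
have [L2du uE] := H1_continuous_primitive cu H1u.
have [/L2_spaceP L2ddu _] := wu.
have [c0 puc] := weak_derivative_ae_primitive L2p wu.
have i_f := square_integrable_integrable L2f.
have iddu := square_integrable_integrable L2ddu.
have idu := square_integrable_integrable L2du.
have intddu x : 0 <= x <= 1 -> segint 0 x (wderiv (wderiv u)) = - segint 0 x f.
  move=> /andP[x0 x1]; rewrite -mulN1r -segintZ; last exact: integrable_onW i_f.
  apply: segint_ae_eq; first exact: integrable_onW iddu.
    apply: integrable_on_measurable; apply: integrable_onZ; exact: integrable_onW i_f.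
  move: u''f; apply: (@filterS _ _ (ae_filter_ringOfSetsType mu)) => t /= ft.
  rewrite in_itv/= => /andP[t0 tx]; have <- : - wderiv (wderiv u) t = f t.
    by apply: ft; rewrite in_itv/= t0 (lt_le_trans tx x1).
  by rewrite mulN1r opprK.
pose P x := c0 - segint 0 x f; exists P; have P0 : P 0 = c0 by rewrite /P segint_xx subr0.
have duP : {ae mu, forall x, x \in `]0, 1[ -> wderiv u x = P x}.
  move: puc; apply: (@filterS _ _ (ae_filter_ringOfSetsType mu)) => t /= pt t01.
  rewrite pt// intddu//; move: t01; rewrite in_itv/= => /andP[t0 t1].
  by rewrite !ltW.
have cP : {within `[0%R, 1%R], continuous P}.
  apply: within_continuousB; first exact: within_continuous_cst.
  exact: segint_primitive_continuous.
split=> //; first by move=> x _; rewrite P0.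
move=> x /[dup] x01 /andP[x0 x1]; rewrite uE// u0 add0r.
apply: segint_ae_eq; first exact: integrable_onW idu.
  apply: integrable_on_measurable; apply: integrable_onW (integrable_on_continuous cP) => //.
move: duP; apply: (@filterS _ _ (ae_filter_ringOfSetsType mu)) => t /= pt.
rewrite in_itv/= => /andP[t0 tx]; apply: pt.
by rewrite in_itv/= t0 (lt_le_trans tx x1).
Qed.

(** With r the barycentric coordinate of x, the error is the combination
    r \int_x^b f - (1 - r) \int_a^x f of two complementary integrals. *)
Lemma interpolation_error a b f F x : a <= x <= b -> a < b -> integrable_on a b f ->
  (forall y, a <= y <= b -> F y = F a - segint a y f) ->
  `|F x - (F a + (F b - F a) * rescale a (b - a) x)| <= segint a b (fun y => `|f y|).
Proof.
move=> xab ab i_f FE; have /andP[ax xb] := xab.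
rewrite (FE _ xab) (FE b) ?lexx ?(ltW ab)//.
set r := rescale _ _ _; have r0 : 0 <= r.
  by apply: divr_ge0; rewrite subr_ge0// ltW.
have r1 : r <= 1 by rewrite ler_pdivrMr ?subr_gt0// mul1r lerB.
have i1 := integrable_onW (lexx a) xb i_f; have i2 := integrable_onW ax (lexx b) i_f.
rewrite (segint_chasles ax xb i_f) (segint_chasles ax xb (integrable_on_norm i_f)).
have := segint_norm_le i1; have := segint_norm_le i2.
set A := segint a x f; set B := segint x b f => hB hA.
have -> : F a - A - (F a + (F a - (A + B) - F a) * r) = r * B - (1 - r) * A by ring.
apply: le_trans (ler_normB _ _) _; rewrite addrC; apply: lerD.
  apply: le_trans hA; rewrite normrM ler_piMl// ger0_norm; lra.
by apply: le_trans hB; rewrite normrM ler_piMl// ger0_norm.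
Qed.

Lemma normL2_le F M : integrable_on 0 1 (fun x => F x ^+ 2) -> 0 <= M ->
  segint 0 1 (fun x => F x ^+ 2) <= M ^+ 2 -> normL2 F <= M.
Proof.
move=> iF M0 FM.
have FF : (fun x => F x * F x) = (fun x => F x ^+ 2).
  by apply/funext => x; rewrite expr2.
rewrite /normL2 dotL2_segint FF; last exact: integrable_on_measurable iF.
by apply: le_trans (ler_wsqrtr FM) _; rewrite sqrtr_sqr ger0_norm.
Qed.

Section Elements.
Variables (T : seq R).
Hypothesis hT : itv_partition 0 1 T.

Let vl k : (k < size T)%N -> vertex T k <= vertex T k.+1.
Proof. by move=> kT; exact/ltW/vertex_ltS. Qed.

Lemma integrable_on_element F k : (k < size T)%N -> integrable_on 0 1 F ->
  integrable_on (vertex T k) (vertex T k.+1) F.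
Proof.
move=> kT; apply: integrable_onW; first exact/vertex_ge0/ltnW.
exact: vertex_le1.
Qed.

Lemma square_integrable_element F k : (k < size T)%N -> square_integrable 0 1 F ->
  square_integrable (vertex T k) (vertex T k.+1) F.
Proof.
move=> kT; apply: square_integrableW; first exact/vertex_ge0/ltnW.
exact: vertex_le1.
Qed.

Lemma segint_mesh1 F : integrable_on 0 1 F ->
  segint 0 1 F = \sum_(k < size T) segint (vertex T k) (vertex T k.+1) F.
Proof.
move=> iF; have [|_] := @segint_mesh _ T F (size T) hT (leqnn _).
  by move=> k kT; exact: integrable_on_element.
by rewrite vertex_size.
Qed.

Lemma sum_mesh_step : \sum_(k < size T) mesh_step T k = 1.
Proof.
rewrite -[RHS](vertex_size hT) -[RHS]subr0 -(vertex0 T).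
by rewrite -(telescope_sumr _ (leq0n (size T))) big_mkord.
Qed.

Lemma segint_P_element p k : P_space T p -> (k < size T)%N ->
  segint (vertex T k) (vertex T k.+1) p =
  mesh_step T k * ((p (vertex T k) + p (vertex T k.+1)) / 2).
Proof.
move=> Pp kT; have hk := mesh_step_gt0 hT kT.
set p0 := p (vertex T k); set dp := p (vertex T k.+1) - p0.
have iid := integrable_on_continuous (@within_continuous_id R 0 1).
have i1 := integrable_on_cst (0 : R) 1 p0.
have i2 := integrable_onZ dp iid.
have := segint_rescale (vertex T k) hk (integrable_onD i1 i2).
rewrite mulr0 mulr1 addr0 -vertexS (segintD i1 i2) (segintZ _ iid).
rewrite segint_cst// segint_id => e.
transitivity (mesh_step T k * (p0 * (1 - 0) + dp * 2^-1)).
  by rewrite -e; apply: segint_eq => x kx; rewrite (P_space_element hT Pp kT kx).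
by rewrite /dp; congr (_ * _); field.
Qed.

Lemma segint_P_mesh p m : P_space T p -> (m <= size T)%N ->
  segint 0 (vertex T m) p =
  \sum_(k < m) mesh_step T k * ((p (vertex T k) + p (vertex T k.+1)) / 2).
Proof.
move=> Pp mT; have [cp _] := Pp; have ip := integrable_on_continuous cp.
have [|_ ->] := @segint_mesh _ T p m hT mT.
  by move=> k km; apply: integrable_on_element ip; exact: leq_trans mT.
by apply: eq_bigr => k _; rewrite segint_P_element// (leq_trans (ltn_ord k)).
Qed.

Section FluxError.
Variables f P pT : R -> R.
Hypothesis L2f : square_integrable 0 1 f.
Hypothesis PE : forall x, 0 <= x <= 1 -> P x = P 0 - segint 0 x f.
Hypothesis intP : segint 0 1 P = 0.
Hypothesis PpT : P_space T pT.
Hypothesis flux : forall m, (m <= size T)%N ->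
  pT (vertex T m) - pT 0 = - segint 0 (vertex T m) f.
Hypothesis intpT : segint 0 1 pT = 0.

Let H := mesh_size T.
Let N2 := segint 0 1 (fun x => f x ^+ 2).
Let N := Num.sqrt N2.
Let e := pT 0 - P 0.

Let i_f : integrable_on 0 1 f. Proof. exact: square_integrable_integrable. Qed.

Let N2_ge0 : 0 <= N2.
Proof. by apply: segint_ge0 => x _; exact: sqr_ge0. Qed.

Let N_ge0 : 0 <= N. Proof. exact: sqrtr_ge0. Qed.

Let sqrN : N ^+ 2 = N2. Proof. exact: sqr_sqrtr. Qed.

Let cP : {within `[0%R, 1%R], continuous P}.
Proof.
apply: (@H1_on_continuous _ 0 1) => //; exists (fun x => - 1 * f x).
  exact: square_integrableZ.
move=> x /[dup] x01 /andP[x0 x1]; rewrite PE// segintZ ?mulN1r//.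
exact: integrable_onW i_f.
Qed.

Let cpT : {within `[0%R, 1%R], continuous pT}. Proof. by case: PpT. Qed.

Let E x := P x - pT x + e.

Let cE : {within `[0%R, 1%R], continuous E}.
Proof.
apply: within_continuousD; last exact: within_continuous_cst.
exact: within_continuousB.
Qed.

(** E vanishes at all vertices by conservation, so it is the error of nodal
    interpolation of P. *)
Lemma segint_flux_interpolation_sqr : segint 0 1 (fun x => E x ^+ 2) <= H ^+ 2 * N2.
Proof.
have [_ iE2] := square_integrable_continuous cE; have [_ if2] := L2f.
rewrite (segint_mesh1 iE2) /N2 (segint_mesh1 if2) mulr_sumr; apply: ler_sum => k _.
have kT := ltn_ord k; have hk := mesh_step_gt0 hT kT; have kk := vertex_ltS hT kT.
have v0 := vertex_ge0 hT (ltnW kT); have v1 := vertex_le1 hT kT.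
have L2k := square_integrable_element kT L2f.
have ik := square_integrable_integrable L2k.
have Pk y : vertex T k <= y <= vertex T k.+1 ->
    P y = P (vertex T k) - segint (vertex T k) y f.
  move=> /andP[ky yk]; have y1 := le_trans yk v1.
  rewrite (PE (x := y)) ?(le_trans v0 ky)// (PE (x := vertex T k)) ?v0 ?(le_trans ky)//.
  by rewrite (segint_chasles v0 ky (integrable_onW (lexx 0) y1 i_f)); ring.
have node m : (m <= size T)%N -> pT (vertex T m) = P (vertex T m) + e.
  move=> mT; have := flux mT.
  by rewrite (PE (x := vertex T m)) ?vertex_ge0 ?vertex_le1// /e; lra.
set M := segint (vertex T k) (vertex T k.+1) (fun y => `|f y|).
have EM x : vertex T k <= x <= vertex T k.+1 -> E x ^+ 2 <= M ^+ 2.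
  move=> kx; have := interpolation_error kx kk ik Pk.
  rewrite -/(mesh_step T k) -/M => EM.
  have M0 : 0 <= M by apply: le_trans EM; exact: normr_ge0.
  rewrite -(real_normK (num_real (E x))) ler_sqr ?nnegrE//.
  apply: le_trans EM; rewrite le_eqVlt; apply/orP; left; apply/eqP; congr `|_|.
  by rewrite /E (P_space_element hT PpT kT kx) !node//; [ring|exact: ltnW].
apply: (@le_trans _ _ (mesh_step T k * M ^+ 2)).
  rewrite mulrC -(segint_cst (M ^+ 2) (vl kT)); apply: segint_le => //.
    exact: integrable_on_element.
  exact: integrable_on_cst.
have hH : mesh_step T k <= H := mesh_step_le_size kT.
apply: (@le_trans _ _ (mesh_step T k * (mesh_step T k *
    segint (vertex T k) (vertex T k.+1) (fun x => f x ^+ 2)))).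
  by rewrite ler_pM2l//; exact: (sqr_segint_norm_le (ltW kk) L2k).
rewrite mulrA -expr2; apply: ler_wpM2r; first by apply: segint_ge0 => x _; exact: sqr_ge0.
by rewrite ler_sqr ?nnegrE ?mesh_size_ge0// ltW.
Qed.

(** Pythagoras: P - pT has zero mean, so it is orthogonal to the constant e. *)
Lemma segint_flux_error_sqr :
  segint 0 1 (fun x => (P x - pT x) ^+ 2) + e ^+ 2 <= H ^+ 2 * N2.
Proof.
have cD := within_continuousB cP cpT; have [_ iD2] := square_integrable_continuous cD.
have iD := integrable_on_continuous cD.
have i2 := integrable_onZ (2 * e) iD; have i3 := integrable_on_cst (0 : R) 1 (e ^+ 2).
apply: le_trans segint_flux_interpolation_sqr; rewrite le_eqVlt; apply/orP; left; apply/eqP.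
rewrite [RHS](@segint_eq _ _ _ _ (fun x => ((P x - pT x) ^+ 2 + 2 * e * (P x - pT x)) +
  e ^+ 2)); last by move=> x _; rewrite /E; ring.
rewrite (segintD (integrable_onD iD2 i2) i3) (segintD iD2 i2) (segintZ _ iD).
rewrite (segintB (integrable_on_continuous cP) (integrable_on_continuous cpT)) intP intpT.
by rewrite segint_cst//; ring.
Qed.

Lemma flux_error : segint 0 1 (fun x => (P x - pT x) ^+ 2) <= (H * N) ^+ 2.
Proof.
rewrite exprMn sqrN; apply: le_trans segint_flux_error_sqr.
by rewrite lerDl sqr_ge0.
Qed.

Lemma node_shift_le : `|e| <= H * N.
Proof.
rewrite -ler_sqr ?nnegrE ?mulr_ge0 ?mesh_size_ge0// real_normK ?num_real//.
rewrite exprMn sqrN; apply: le_trans segint_flux_error_sqr.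
by rewrite lerDr; apply: segint_ge0 => x _; exact: sqr_ge0.
Qed.

(** P oscillates by at most the integral of |f| and has zero mean. *)
Lemma exact_flux_bound y : 0 <= y <= 1 -> `|P y| <= N.
Proof.
move=> y01; have NN : segint 0 1 (fun x => `|f x|) <= N.
  by apply: segint_norm_le_sqrt => //; rewrite sqrN.
have osc z : 0 <= z <= 1 -> `|P y - P z| <= N.
  move=> z01; apply: le_trans NN; rewrite (PE y01) (PE z01).
  move/andP: y01 => [y0 y1]; move/andP: z01 => [z0 z1].
  have [yz|/ltW zy] := leP y z.
    rewrite (segint_chasles y0 yz (integrable_onW (lexx 0) z1 i_f)).
    rewrite (_ : _ - _ = segint y z f); last ring.
    exact: segint_norm_le01.
  rewrite (segint_chasles z0 zy (integrable_onW (lexx 0) y1 i_f)).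
  rewrite (_ : _ - _ = - segint z y f); last ring.
  by rewrite normrN; exact: segint_norm_le01.
have iP := integrable_on_continuous cP.
have lo : segint 0 1 (fun=> P y - N) <= segint 0 1 P.
  apply: segint_le => //; first exact: integrable_on_cst.
  by move=> z /osc; rewrite ler_norml; lra.
have hi : segint 0 1 P <= segint 0 1 (fun=> P y + N).
  apply: segint_le => //; first exact: integrable_on_cst.
  by move=> z /osc; rewrite ler_norml; lra.
by move: lo hi; rewrite !segint_cst// intP ler_norml; lra.
Qed.

Lemma value_error k x : (k < size T)%N -> vertex T k <= x <= vertex T k.+1 ->
  `|segint 0 x P - (segint 0 (vertex T k) pT + mesh_step T k * pT (vertex T k) / 2)|
    <= 3 * (H * N).
Proof.
move=> kT /andP[kx xk]; have hk := mesh_step_gt0 hT kT.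
have v0 := vertex_ge0 hT (ltnW kT); have v1 := vertex_le1 hT kT.
have x1 := le_trans xk v1; have vk1 := le_trans kx x1.
have hH : mesh_step T k <= H := mesh_step_le_size kT.
have H1 : H <= 1 := mesh_size_le1 hT.
have cD := within_continuousB cP cpT; have iP := integrable_on_continuous cP.
have iPk := integrable_onW (lexx 0) vk1 iP.
have ipTk := integrable_onW (lexx 0) vk1 (integrable_on_continuous cpT).
have HN0 : 0 <= H * N by rewrite mulr_ge0// mesh_size_ge0.
have b1 : `|segint 0 (vertex T k) (fun x => P x - pT x)| <= H * N.
  have iD := segint_norm_le01 (lexx 0) v0 vk1 (integrable_on_continuous cD).
  apply: le_trans iD _; apply: segint_norm_le_sqrt => //; last exact: flux_error.
  exact: square_integrable_continuous.
have b2 : `|segint (vertex T k) x P| <= H * N.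
  have iPx := integrable_onW v0 x1 iP.
  apply: le_trans (segint_norm_le iPx) _.
  apply: (@le_trans _ _ (segint (vertex T k) x (fun=> N))).
    apply: segint_le; [exact: integrable_on_norm|exact: integrable_on_cst|].
    by move=> y /andP[ky yx]; apply: exact_flux_bound; rewrite (le_trans v0 ky) (le_trans yx x1).
  rewrite segint_cst// mulrC ler_wpM2r// (le_trans _ hH)// /mesh_step; lra.
have b3 : `|mesh_step T k * pT (vertex T k) / 2| <= H * N.
  have pk : `|pT (vertex T k)| <= 2 * N.
    have -> : pT (vertex T k) = P (vertex T k) + e.
      have := flux (ltnW kT).
      by rewrite (PE (x := vertex T k)) ?v0 ?vk1// /e; lra.
    apply: le_trans (ler_normD _ _) _.
    have Pv : `|P (vertex T k)| <= N by apply: exact_flux_bound; rewrite v0 vk1.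
    have := node_shift_le; have : H * N <= N by rewrite ler_piMl.
    lra.
  rewrite -mulrA normrM (gtr0_norm hk); apply: ler_pM => //; first exact: ltW.
  by move: pk; rewrite !ler_norml; lra.
rewrite (segint_chasles v0 kx (integrable_onW (lexx 0) x1 iP)).
move: b1; rewrite (segintB iPk ipTk).
move: b2 b3; rewrite !ler_norml; lra.
Qed.

End FluxError.
End Elements.
End Estimate.

Section Assembly.
Context {R : realType}.
Local Notation mu := (@lebesgue_measure R).

(** The coefficients c_i = 1 for i <= k and 0 otherwise select the value of uT on
    the element k, the only one on which c jumps. *)
Lemma fv_value (psi f uT pT : R -> R) (T : seq R) (k : nat) :
  {within `[0%R, 1%R], continuous psi} -> H1_space psi -> psi 0 = 0 ->
  (forall t, 0 <= t <= 1 -> psi t + psi (1 - t) = 1) ->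
  segint 0 1 (fun x => (1 - x) * psi x) = 0 ->
  itv_partition 0 1 T -> fv_solution psi T f uT pT -> (k < size T)%N ->
  element_value T uT k =
    segint 0 (vertex T k) pT + mesh_step T k * pT (vertex T k) / 2.
Proof.
move=> cpsi Hpsi psi0 psi_sym psi_orth hT solT kT; have [_ PpT _] := solT.
have := fv_gradient cpsi Hpsi psi0 psi_sym psi_orth hT solT
  (fun i => (i <= k)%N%:R).
have tail (G : nat -> R) : (forall j, (k < j)%N -> G j = 0) ->
    \sum_(j < size T) G j = \sum_(j < k) G j + G k.
  move=> G0; rewrite -(big_mkord xpredT G) (big_cat_nat (n := k))//; last exact: ltnW.
  have rest0 : \sum_(k.+1 <= j < size T) G j = 0.
    by rewrite big_nat_cond big1// => j /andP[/andP[kj _] _]; exact: G0.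
  by rewrite /= big_mkord (big_ltn kT) rest0 addr0.
have above j : (k < j)%N -> ((j <= k)%N = false) * ((j < k)%N = false).
  by move=> kj; rewrite leqNgt kj ltnNge (ltnW kj).
rewrite (tail (fun j => mesh_step T j * ((pT (vertex T j) * (j <= k)%N%:R +
  pT (vertex T j.+1) * (j.+1 <= k)%N%:R) / 2))); last first.
  by move=> j /above kj; rewrite !kj !mulr0 addr0 mul0r mulr0.
rewrite (tail (fun j => element_value T uT j *
  ((j.+1 <= k)%N%:R - (j <= k)%N%:R))); last first.
  by move=> j /above kj; rewrite !kj subrr mulr0.
rewrite (segint_P_mesh hT PpT (ltnW kT)) leqnn ltnn /= [X in _ + (X + _)]big1; last first.
  by move=> j _; rewrite ltn_ord ltnW ?ltn_ord//= subrr mulr0.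
under eq_bigr do rewrite ltn_ord (ltnW (ltn_ord _)) !mulr1.
set S := \sum_(_ < _) _; lra.
Qed.

End Assembly.

Theorem theorem5 (R : realType) (alpha beta : R) :
  0 < alpha -> alpha < 1 -> 1 < beta ->
  exists C : R,
  forall psi : R -> R,
    {within `[0%R, 1%R], continuous psi} ->
    H1_space psi ->
    psi 0 = 0 ->
    (forall theta : R, 0 <= theta <= 1 -> psi theta + psi (1 - theta) = 1) ->
    Rintegral (@lebesgue_measure R) `[0%R, 1%R]
      (fun x : R => (1 - x) * psi x) = 0 ->
  forall f : R -> R, L2_space f ->
  forall u : R -> R, poisson_solution f u ->
  forall p : R -> R, p = wderiv u ->
  forall T : seq R, uniformly_regular alpha beta T ->
  forall uT pT : R -> R, fv_solution psi T f uT pT ->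
    normL2 (fun x => u x - uT x) + normL2 (fun x => p x - pT x)
      <= C * mesh_size T * normL2 f.
Proof.
(* h |f| for the flux and 3 h |f| for the values. *)
move=> _ _ _; exists 4 => psi cpsi Hpsi psi0 psi_sym psi_orth f L2f u solu p ->.
move=> T [hT _] uT pT solT; have [UuT PpT _] := solT; have [cpT _] := PpT.
have [P [cP PE duP L2du uE]] := poisson_primitive L2f solu.
move/L2_spaceP : L2f => L2f; have [cu _ _ [_ u1]] := solu.
have intP : segint 0 1 P = 0 by rewrite -uE ?u1 ?lexx ?ler01.
have flux := fv_flux hT L2f solT.
have intpT : segint 0 1 pT = 0.
  rewrite -(vertex_size hT) (segint_P_mesh hT PpT)//.
  have := fv_gradient cpsi Hpsi psi0 psi_sym psi_orth hT solT (fun=> 1).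
  rewrite [X in _ + X]big1 ?addr0; last by move=> k _; rewrite subrr mulr0.
  by under eq_bigr do rewrite !mulr1.
pose N := Num.sqrt (segint 0 1 (fun x => f x ^+ 2)).
have NE : normL2 f = N.
  have ff : (fun x => f x * f x) = (fun x => f x ^+ 2).
    by apply/funext => x; rewrite expr2.
  rewrite /normL2 dotL2_segint ff//.
  by case: L2f => _ /integrable_on_measurable.
have HN0 : 0 <= mesh_size T * N by rewrite mulr_ge0 ?mesh_size_ge0 ?sqrtr_ge0.
have pest : normL2 (fun x => wderiv u x - pT x) <= mesh_size T * N.
  have [_ i2] := square_integrableB L2du (square_integrable_continuous cpT).
  apply: normL2_le => //; apply: le_trans (flux_error hT L2f PE intP PpT flux intpT).
  rewrite le_eqVlt; apply/orP; left; apply/eqP; apply: segint_ae_eq => //.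
    apply: integrable_on_measurable.
    exact: (square_integrable_continuous (within_continuousB cP cpT)).2.
  move: duP; apply: (@filterS _ _ (ae_filter_ringOfSetsType lebesgue_measure)) => t /= pt t01.
  by rewrite pt.
have uest : normL2 (fun x => u x - uT x) <= 3 * (mesh_size T * N).
  have hval := value_error hT L2f PE intP PpT flux intpT.
  have vl k : (k < size T)%N -> vertex T k <= vertex T k.+1.
    by move=> kT; exact/ltW/vertex_ltS.
  have uk k : (k < size T)%N -> forall x, vertex T k < x < vertex T k.+1 ->
      (u x - element_value T uT k) ^+ 2 = (u x - uT x) ^+ 2.
    by move=> kT x kx; rewrite (U_space_element UuT kT kx).
  have ci k : (k < size T)%N -> integrable_on (vertex T k) (vertex T k.+1)
      (fun x => (u x - element_value T uT k) ^+ 2).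
    move=> kT; apply: (proj2 (square_integrable_continuous _)).
    apply: within_continuousB; last exact: within_continuous_cst.
    by apply: within_continuousW cu; [exact/vertex_ge0/ltnW|exact: vertex_le1].
  have iu k (kT : (k < size T)%N) := integrable_on_eq_oo (uk _ kT) (ci _ kT).
  have [i01 e01] := segint_mesh hT (leqnn _) iu; rewrite vertex_size// in i01 e01.
  apply: normL2_le => //; first by rewrite mulr_ge0.
  (* The pointwise bound is integrated over elements of total length 1. *)
  set M2 := _ ^+ 2; have -> : M2 = \sum_(k < size T) mesh_step T k * M2.
    by rewrite -mulr_suml sum_mesh_step// mul1r.
  rewrite e01; apply: ler_sum => k _.
  have kT := ltn_ord k.
  rewrite -(segint_eq_oo (integrable_on_measurable (ci _ kT)) (uk _ kT)).
  rewrite mulrC -(segint_cst _ (vl _ kT)); apply: segint_le; [exact: ci|exact: integrable_on_cst|].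
  move=> x kx; have := hval _ _ kT kx.
  rewrite -(fv_value cpsi Hpsi psi0 psi_sym psi_orth hT solT kT) -uE; last first.
    case/andP: kx => kx xk; rewrite (le_trans _ kx) ?vertex_ge0 1?ltnW//.
    by rewrite (le_trans xk)// vertex_le1.
  move=> ub; rewrite -(real_normK (num_real (u x - _))).
  have M0 : 0 <= 3 * (mesh_size T * N) by rewrite mulr_ge0.
  by rewrite /M2 ler_sqr ?nnegrE//; exact: ub.
rewrite NE; move: pest uest; lra.
Qed.
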